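(* Let $\mathcal{C}\subset\mathbb{R}^p$ be a closed bounded convex set with Euclidean diameter $\|\mathcal{C}\|_2$, and let $\ell(\cdot;d):\mathcal{C}\to\mathbb{R}$ be convex and $L$-Lipschitz for every $d$ in the data universe. Let $\mathcal{D}=\{d_1,\dots,d_n\}$ be a data set, $\mathcal{L}(\theta;\mathcal{D})=\sum_{i=1}^n\ell(\theta;d_i)$ and $\theta^*\in\arg\min_{\theta\in\mathcal{C}}\mathcal{L}(\theta;\mathcal{D})$. Let $\sigma^2=O\left(\frac{L^2n^2\log(n/\delta)\log(1/\delta)}{\epsilon^2}\right)$ be the noise variance used in the algorithm $\mathcal{A}_{\sf Noise-GD}$ (described in the context), and let $\theta^{priv}$ be its output. Then, with expectation over the randomness of the algorithm: 1. (Lipschitz functions) If the learning rate function is $\eta(t)=\frac{\|\mathcal{C}\|_2}{\sqrt{t(n^2L^2+p\sigma^2)}}$, then $$\mathbb{E}\left[\mathcal{L}(\theta^{priv};\mathcal{D})-\mathcal{L}(\theta^*;\mathcal{D})\right]=O\left(\frac{L\|\mathcal{C}\|_2\log^{3/2}(n/\delta)\sqrt{p\log(1/\delta)}}{\epsilon}\right).$$ 2. (Lipschitz and strongly convex functions) If, in addition, $\ell(\cdot;d)$ is $\Delta$-strongly convex on $\mathcal{C}$ for every $d$, and the learning rate function is $\eta(t)=\frac{1}{\Delta nt}$, then $$\mathbb{E}\left[\mathcal{L}(\theta^{priv};\mathcal{D})-\mathcal{L}(\theta^*;\mathcal{D})\right]=O\left(\frac{L^2\log^2(n/\delta)\,p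\log(1/\delta)}{n\Delta\epsilon^2}\right).$$
   Context: $O(\cdot)$ hides absolute multiplicative constants. Lipschitz and strong convexity are with respect to the Euclidean norm; $f$ is $\Delta$-strongly convex on $\mathcal{C}$ if $f(y)\ge f(x)+\langle z,y-x\rangle+\frac{\Delta}{2}\|y-x\|_2^2$ for all $x,y\in\mathcal{C}$ and all subgradients $z$ of $f$ at $x$. $\Pi_{\mathcal{C}}$ denotes Euclidean projection onto $\mathcal{C}$. $\epsilon,\delta$ are the privacy parameters given to the algorithm. Algorithm $\mathcal{A}_{\sf Noise-GD}$ (inputs: $\mathcal{D}$, $\ell$ with Lipschitz constant $L$, $\epsilon,\delta$, $\mathcal{C}$, learning rate $\eta:\{1,\dots,n^2\}\to\mathbb{R}$): 1. Set the noise variance $\sigma^2$ (the algorithm's choice is $\sigma^2=\frac{32L^2n^2\log(n/\delta)\log(1/\delta)}{\epsilon^2}$). 2. Choose any point $\tilde\theta_1\in\mathcal{C}$. 3. For $t=1,\dots,n^2-1$: pick $d$ uniformly at random from the $n$ entries of $\mathcal{D}$ (with replacement across steps), draw $b_t\sim\mathcal{N}(0,\mathbb{I}_p\sigma^2)$ independently, and set $\tilde\theta_{t+1}=\Pi_{\mathcal{C}}\left(\tilde\theta_t-\eta(t)\left[n\nabla\ell(\tilde\theta_t;d)+b_t\right]\right)$. Here $\nabla\ell(\tilde\theta_t;d)$ is the gradient (or, if $\ell$ is not differentiable, any subgradient) of $\ell(\cdot;d)$ at $\tilde\theta_t$. 4. Output $\theta^{priv}=\tilde\theta_{n^2}$.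
   Formalization: The O-constant may depend on K (constant in the hypothesis on σ²) and on arbitrary upper bounds ε≤ε₀, δ≤δ₀<1 (a constant uniform in all ε, δ fails at n=1, ε→∞); the subgradients used are assumed to have norm ≤L (false otherwise at boundary points of C) and to be Borel measurable in θ. *)

(* Defs.v *)
From HB Require Import structures.
From mathcomp Require Import all_boot all_order all_algebra.
From mathcomp Require Import all_classical all_reals all_analysis.
Import Order.TTheory GRing.Theory Num.Theory.
Import numFieldNormedType.Exports.
Set Implicit Arguments.
Unset Strict Implicit.
Unset Printing Implicit Defensive.
Local Open Scope classical_set_scope.
Local Open Scope ring_scope.

Section Euclidean.
Variables (R : realType) (p : nat).
Implicit Types (C : set 'rV[R]_p) (x y z : 'rV[R]_p).

Definition dot x y : R := \sum_(i < p) x 0 i * y 0 i.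

(* The library norm of 'rV[R]_p is the sup norm; it induces the same topology
   and the same bounded sets. *)
Definition norm2 x : R := Num.sqrt (dot x x).

Definition diam2 C : R :=
  sup [set r | exists x y, [/\ C x, C y & r = norm2 (x - y)]].

Definition is_proj C x y := C y /\ forall z, C z -> norm2 (x - y) <= norm2 (x - z).

(* Unique when C is closed, convex and nonempty. *)
Definition proj C x : 'rV[R]_p := xget 0 [set y | is_proj C x y].

Definition lipschitz2 C (L : R) (f : 'rV[R]_p -> R) :=
  forall x y, C x -> C y -> `|f x - f y| <= L * norm2 (x - y).

Definition subgradient C (f : 'rV[R]_p -> R) x z :=
  forall y, C y -> f x + dot z (y - x) <= f y.

Definition strongly_convex C (Delta : R) (f : 'rV[R]_p -> R) :=
  forall x y z, C x -> C y -> subgradient C f x z ->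
    f x + dot z (y - x) + Delta / 2 * norm2 (y - x) ^+ 2 <= f y.

Definition is_argmin C (f : 'rV[R]_p -> R) x :=
  C x /\ forall y, C y -> f x <= f y.

Definition Borel_rV := g_sigma_algebraType (@open 'rV[R]_p).

(* The subgradient used by the algorithm at theta on the data point d.
   A subgradient of an L-Lipschitz f : C -> R has norm at most L at interior
   points of C; at a boundary point arbitrarily long outward normal vectors may
   be added to it, so the bound has to be part of the specification.
   Measurability makes the iterates random variables. *)
Definition subgradient_oracle C (L : R) (U : Type) (l : 'rV[R]_p -> U -> R)
    (g : 'rV[R]_p -> U -> 'rV[R]_p) :=
  forall d, [/\ measurable_fun (C : set Borel_rV) (g ^~ d : Borel_rV -> Borel_rV),
    forall x, C x -> subgradient C (l ^~ d) x (g x d)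
    & forall x, C x -> norm2 (g x d) <= L].

End Euclidean.

Definition total_loss (R : realType) (p n : nat) (U : Type)
    (l : 'rV[R]_p -> U -> R) (D : 'I_n -> U) (theta : 'rV[R]_p) : R :=
  \sum_(i < n) l theta (D i).

Section Randomness.
Context {d : measure_display} {Omega : measurableType d} {R : realType}.
Variable P : probability Omega R.

Definition independent_classes (I : finType) (F : I -> set (set Omega)) :=
  forall (J : {set I}) (E : I -> set Omega), (forall i, i \in J -> F i (E i)) ->
    P (\bigcap_(i in [set` J]) E i) = (\prod_(i in J) P (E i))%E.

(* normal_prob 0 0 is not the point mass at 0. *)
Definition centered_gaussian (s : R) : set (measurableTypeR R) -> \bar R :=
  if s == 0 then \d_(0 : measurableTypeR R) else normal_prob 0 s.

Definition draw_events (n p N : nat) (pick : nat -> Omega -> 'I_n)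
    (b : nat -> 'I_p -> {RV P >-> R}) (k : 'I_N + 'I_N * 'I_p) : set (set Omega) :=
  match k with
  | inl t => preimage_set_system setT (pick t) setT
  | inr (t, j) => preimage_set_system setT (b t j) measurable
  end.

(* For t < N, pick t is uniform on the n entries, and
   b t 0, ..., b t (p - 1) are the coordinates of b_t ~ N(0, s^2 I_p), i.e. they
   are i.i.d. N(0, s^2); all of these variables are mutually independent. *)
Definition noise_gd_draws (n p N : nat) (s : R) (pick : nat -> Omega -> 'I_n)
    (b : nat -> 'I_p -> {RV P >-> R}) :=
  [/\ forall t i, (t < N)%N -> measurable (pick t @^-1` [set i]),
      forall t i, (t < N)%N -> P (pick t @^-1` [set i]) = (n%:R^-1)%:E,
      forall t j A, (t < N)%N -> measurable A ->
        distribution P (b t j) A = centered_gaussian s A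
    & independent_classes (@draw_events n p N pick b)].

End Randomness.

(* The iterates theta_1, theta_2, ... are indexed from 1: noise_gd_iter k is
   theta_(k+1), and step t = k+1, from theta_t to theta_(t+1), uses eta t and the
   draws number k. *)
Fixpoint noise_gd_iter (R : realType) (p n : nat) (U : Type)
    (C : set 'rV[R]_p) (g : 'rV[R]_p -> U -> 'rV[R]_p) (D : 'I_n -> U)
    (eta : nat -> R) (theta1 : 'rV[R]_p)
    (pick : nat -> 'I_n) (b : nat -> 'rV[R]_p) (k : nat) : 'rV[R]_p :=
  match k with
  | 0%N => theta1
  | k'.+1 =>
      let theta := noise_gd_iter C g D eta theta1 pick b k' in
      proj C (theta - eta k'.+1 *: (n%:R *: g theta (D (pick k')) + b k'))
  end.

(* theta^priv = theta_(n^2), as a function on the sample space. *)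
Definition theta_priv (T : Type) (R : realType) (p n : nat) (U : Type)
    (C : set 'rV[R]_p) (g : 'rV[R]_p -> U -> 'rV[R]_p) (D : 'I_n -> U)
    (eta : nat -> R) (theta1 : 'rV[R]_p)
    (pick : nat -> T -> 'I_n) (b : nat -> 'I_p -> T -> R) (w : T) : 'rV[R]_p :=
  noise_gd_iter C g D eta theta1 (pick ^~ w) (fun t => \row_(j < p) b t j w)
    (n ^ 2).-1.

(* Main.v *)
(* The proof is the last-iterate analysis of Shamir and Zhang.  One step of the
   algorithm, compared with a point w of C that depends only on earlier draws,
   gives in expectation
     E F(theta_t) - E F(w) <= (1/(2 eta_t) - mu/2) E|theta_t - w|^2
                              - E|theta_(t+1) - w|^2/(2 eta_t) + eta_t G^2/2,
   where mu = n Delta is the strong convexity modulus of the total loss F (mu = 0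
   in part 1) and G^2 = O(n^2 L^2 + p sigma^2) bounds the second moment of the
   noisy gradient.  Summing over t >= s with w = theta_s makes the tail sums of
   E F(theta_t) - E F(theta_s) small; with w = theta^* it controls the average.
   Abel summation over s then bounds the last value, at the price of a harmonic
   sum, i.e. a factor O(log n).  The cross terms vanish because the draws of
   step t are independent of the sigma-algebra generated by the earlier ones. *)
From HB Require Import structures.
Require Import Defs.
From mathcomp Require Import all_boot all_order all_algebra.
From mathcomp Require Import all_classical all_reals all_analysis.
From mathcomp Require Import measurable_realfun ring lra.
Import Order.TTheory GRing.Theory Num.Theory.
Import numFieldNormedType.Exports.
Set Implicit Arguments.
Unset Strict Implicit.
Unset Printing Implicit Defensive.
Local Open Scope classical_set_scope.
Local Open Scope ring_scope.

(** * Last iterate of a sequence with small tail regret *)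

(** Both parts pass through one rate, [v t <= Q / t]. In part 2 this is the natural size of the
    error terms. In part 1 they are of order [1 / sqrt t], but there are only [n ^ 2] iterates, so
    [sqrt t <= n] trades [1 / sqrt t] for [n / t], and nothing is lost at [t = n ^ 2], where the
    rate is read off. The growth of [1 / (2 eta t)] beyond what strong convexity pays for is
    recorded in a sequence [e]: zero in part 2, proportional to [sqrt t - sqrt (t - 1)] in part 1.
    The final bounds contain the noise term alone, without [n^2 L^2]. The latter is absorbed because
    [eps <= eps0] and [delta <= delta0] keep [ln (n / delta) * ln (1 / delta) / eps^2] away from
    zero; this is how the constant comes to depend on [eps0] and [delta0]. The absorption needs
    [p > 0], and positive step sizes in part 1 need [L] and the diameter to be nonzero; in the
    remaining cases the loss is constant on [C]. *)

Section LastIterate.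
Variable R : realType.

(** This is [ln (1 + x) <= x] at [x = - 1 / (j + 1)]. *)
Lemma inv_natS_le_ln (j : nat) : (0 < j)%N ->
  j.+1%:R^-1 <= ln j.+1%:R - ln j%:R :> R.
Proof.
move=> j0; have j0' : (0 : R) < j%:R by rewrite ltr0n.
have S0 : (0 : R) < j.+1%:R by rewrite ltr0n.
have E : 1 + - j.+1%:R^-1 = j%:R / j.+1%:R :> R.
  by rewrite -natr1; field; rewrite natr1 gt_eqF.
have : -1 < - j.+1%:R^-1 :> R.
  by rewrite ltrN2 invf_lt1// ltr1n ltnS.
move=> /le_ln1Dx; rewrite E ln_div ?posrE// => H.
by rewrite -lerN2 opprB.
Qed.

Lemma harmonic_le_ln (m : nat) : (0 < m)%N ->
  \sum_(1 <= j < m) j%:R^-1 <= 1 + ln m%:R :> R.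
Proof.
have H k : \sum_(1 <= j < k.+2) j%:R^-1 <= 1 + ln k.+1%:R :> R.
  elim: k => [|k IH]; first by rewrite big_nat1 invr1 ln1 addr0.
  rewrite big_nat_recr//=; apply: le_trans (lerD IH (@inv_natS_le_ln k.+1 isT)) _.
  by rewrite -addrA subrKC.
case: m => [//|[_|m _]]; first by rewrite big_geq// ln1 addr0.
by apply: le_trans (H m) _; rewrite lerD2l ler_ln ?posrE ?ltr0n// ler_nat.
Qed.

Variables (a v : nat -> R) (T : nat) (astar Q : R).
Hypothesis T0 : (0 < T)%N.
Hypothesis regret : forall s, (1 <= s <= T)%N ->
  \sum_(s <= t < T.+1) (a t - a s) <= \sum_(s <= t < T.+1) v t.
Hypothesis regret_star :
  \sum_(1 <= t < T.+1) (a t - astar) <= \sum_(1 <= t < T.+1) v t.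

Let sum_subC (c : R) s : (s <= T)%N ->
  \sum_(s <= t < T.+1) (a t - c) = \sum_(s <= t < T.+1) a t - (T - s).+1%:R * c.
Proof.
move=> sT; rewrite big_split/= sumrN sumr_const_nat subSn//.
by rewrite mulr_natl.
Qed.

(* Comparing the averages of the last m+1 and the last m+2 values gives, after an
   Abel summation, an invariant that telescopes up to the average of all values. *)
Lemma last_iterate_suffix (m : nat) : (m < T)%N ->
  a T <= (\sum_(T - m <= t < T.+1) a t) / m.+1%:R + v T
    + \sum_(1 <= j < m.+1) v (T - j)%N / j%:R
    - (\sum_(T - m <= t < T.+1) v t) / m.+1%:R.
Proof.
elim: m => [_|m IH mT].
  by rewrite subn0 !big_nat1 big_geq// divr1; lra.
apply: le_trans (IH (ltnW mT)) _.
have s1 : (1 <= T - m.+1 <= T)%N by rewrite subn_gt0 mT leq_subr.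
have sS : (T - m = (T - m.+1).+1)%N by rewrite subnSK// ltnW.
have := regret s1; rewrite sum_subC ?leq_subr// subKn; last exact: ltnW.
have sT : (T - m.+1 < T.+1)%N by rewrite ltnS leq_subr.
rewrite !(big_ltn sT) -sS (@big_nat_recr _ _ _ m.+1)//=.
set A := \sum_(T - m <= t < _) a t; set V := \sum_(T - m <= t < _) v t.
set a_s := a _; set vs := v _; set H := \sum_(_ <= j < _) _.
have k0 : (0 : R) < m.+1%:R by rewrite ltr0n.
rewrite -[m.+2%:R]natr1; move: k0; move: (m.+1%:R : R) => k k0 E.
have k1 : 0 < k + 1 by lra.
(* With [k = m + 1], [E] is the regret from index [T - m - 1]; the gap to be shown nonnegative is
   its slack divided by [k * (k + 1)]. *)
suff : (A - V) / k <= (a_s + A - vs - V) / (k + 1) + vs / k by lra.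
rewrite -subr_ge0.
have -> : (a_s + A - vs - V) / (k + 1) + vs / k - (A - V) / k =
   (vs + V - (a_s + A - (k + 1) * a_s)) / (k * (k + 1)).
  by field; rewrite !gt_eqF.
by apply: divr_ge0; [lra|apply: mulr_ge0; lra].
Qed.

Lemma last_iterate : a T - astar <= v T + \sum_(1 <= j < T) v (T - j)%N / j%:R.
Proof.
have PT : (T.-1 < T)%N by rewrite prednK.
have T1 : (T - T.-1 = 1)%N by rewrite -subn1 subKn.
have := last_iterate_suffix PT; rewrite prednK// T1.
move: regret_star; rewrite sum_subC// subn1 prednK// => H.
have T0' : (0 : R) < T%:R by rewrite ltr0n.
set S := \sum_(1 <= j < T) _.
move: H; set A := \sum_(1 <= t < _) a t; set V := \sum_(1 <= t < _) v t => H.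
(* At [m = T - 1] the suffix is the whole sequence, whose average [regret_star] compares with
   [astar]. *)
have : A / T%:R - V / T%:R <= astar by rewrite -mulrBl ler_pdivrMr//; lra.
lra.
Qed.

(** Partial fractions, [1 / ((T - j) j) = (1 / j + 1 / (T - j)) / T], turn the convolution into two
    harmonic sums. *)
Lemma last_iterate_rate : 0 <= Q ->
  (forall t, (1 <= t <= T)%N -> v t <= Q / t%:R) ->
  a T - astar <= Q / T%:R * (3 + 2 * ln T%:R).
Proof.
move=> Q0 vQ; apply: le_trans last_iterate _.
pose H : R := \sum_(1 <= j < T) j%:R^-1.
have HS : \sum_(1 <= j < T) v (T - j)%N / j%:R <= Q / T%:R * (H + H).
  have -> : H + H = \sum_(1 <= j < T) (j%:R^-1 + (T - j)%:R^-1).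
    rewrite big_split/=; congr (_ + _); rewrite /H big_nat_rev/=.
    by rewrite add1n; apply: eq_big_nat => j _; rewrite subSS.
  rewrite mulr_sumr; apply: ler_sum_nat => j /andP[j1 jT].
  have j0 : (0 : R) < j%:R by rewrite ltr0n.
  have Tj0 : (0 : R) < (T - j)%:R by rewrite ltr0n subn_gt0.
  apply: (@le_trans _ _ (Q / (T - j)%:R / j%:R)).
    apply: ler_wpM2r; first by rewrite invr_ge0 ltW.
    apply: vQ.
    by rewrite subn_gt0 jT leq_subr.
  have ET : T%:R = (T - j)%:R + j%:R :> R by rewrite -natrD subnK// ltnW.
  rewrite ET le_eqVlt; apply/orP; left; apply/eqP; field.
  by rewrite -ET !gt_eqF// ltr0n.
have vT : v T <= Q / T%:R by apply: vQ; rewrite T0 leqnn.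
have QT : 0 <= Q / T%:R by rewrite divr_ge0.
have : Q / T%:R * H <= Q / T%:R * (1 + ln T%:R).
  by rewrite ler_wpM2l// harmonic_le_ln.
lra.
Qed.

End LastIterate.

(** The terms [al t * d t - be t * d t.+1] telescope up to remainders
    [(al t - be t.-1) * d t <= e t * B]. The last index has no [be] term, since no further distance
    is available. *)
Lemma telescoped_regret (R : realType) (al be d e w : nat -> R) (a : nat -> R)
    (f B : R) (s T : nat) :
  (s <= T)%N ->
  (forall t, (s <= t < T)%N -> a t - f <= al t * d t - be t * d t.+1 + w t) ->
  a T - f <= al T * d T + w T ->
  al s * d s <= e s * B ->
  (forall t, (s < t <= T)%N -> al t - be t.-1 <= e t) ->
  (forall t, (s <= t <= T)%N -> 0 <= e t) ->
  (forall t, (s <= t <= T)%N -> 0 <= d t <= B) ->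
  \sum_(s <= t < T.+1) (a t - f) <= \sum_(s <= t < T.+1) (e t * B + w t).
Proof.
move=> sT step stepT als albe e0 dB.
have ald t : (s < t <= T)%N -> al t * d t <= be t.-1 * d t + e t * B.
  move=> stT; have := albe t stT.
  have /andP[st tT] := stT.
  have /andP[d0 dB'] : 0 <= d t <= B by apply: dB; rewrite (ltnW st).
  have := e0 t; rewrite (ltnW st) tT => /(_ isT) et0 H; nra.
(* The retained negative term in [be] pays for the [al] term of the next index. *)
have inv m : (s + m < T)%N ->
    \sum_(s <= t < (s + m).+1) (a t - f) <=
    \sum_(s <= t < (s + m).+1) (e t * B + w t) - be (s + m)%N * d (s + m).+1.
  elim: m => [|m IH] smT.
    rewrite addn0 in smT *; rewrite !big_nat1.
    by have := step s; rewrite leqnn smT => /(_ isT); lra.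
  rewrite addnS in smT *.
  rewrite big_nat_recr ?leqW ?leq_addr//= [in leRHS]big_nat_recr ?leqW ?leq_addr//=.
  have := IH (ltnW smT); have := step (s + m).+1; rewrite smT leqW ?leq_addr// => /(_ isT).
  have := ald (s + m).+1; rewrite ltnS leq_addr ltnW// => /(_ isT) /=; lra.
have [sTe|sTn] := eqVneq s T.
  by rewrite -sTe !big_nat1 in stepT *; lra.
have sT' : (s < T)%N by rewrite ltn_neqAle sTn.
rewrite big_nat_recr//= [in leRHS]big_nat_recr//=.
have TE : T = (s + (T - s.+1)).+1 by rewrite -addnS subnSK// subnKC.
have := ald T; rewrite sT' leqnn => /(_ isT).
have sT1 : (s + (T - s.+1) < T)%N by rewrite {2}TE.
have := inv _ sT1; rewrite -TE.
have -> : (s + (T - s.+1) = T.-1)%N by rewrite {2}TE.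
lra.
Qed.

(** * Euclidean geometry and projection *)

Section DotProduct.
Variables (R : realType) (p : nat).
Implicit Types (x y z : 'rV[R]_p) (C : set 'rV[R]_p).

Lemma dotC x y : dot x y = dot y x.
Proof. by apply: eq_bigr => i _; rewrite mulrC. Qed.

Lemma dotDl x y z : dot (x + y) z = dot x z + dot y z.
Proof. by rewrite -big_split; apply: eq_bigr => i _; rewrite mxE mulrDl. Qed.

Lemma dotZl a x y : dot (a *: x) y = a * dot x y.
Proof. by rewrite mulr_sumr; apply: eq_bigr => i _; rewrite mxE mulrA. Qed.

Lemma dotNl x y : dot (- x) y = - dot x y.
Proof. by rewrite -scaleN1r dotZl mulN1r. Qed.

Lemma dotBl x y z : dot (x - y) z = dot x z - dot y z.
Proof. by rewrite dotDl dotNl. Qed.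

Lemma dotDr x y z : dot x (y + z) = dot x y + dot x z.
Proof. by rewrite dotC dotDl !(dotC x). Qed.

Lemma dotZr a x y : dot x (a *: y) = a * dot x y.
Proof. by rewrite dotC dotZl dotC. Qed.

Lemma dotNr x y : dot x (- y) = - dot x y.
Proof. by rewrite dotC dotNl dotC. Qed.

Lemma dotBr x y z : dot x (y - z) = dot x y - dot x z.
Proof. by rewrite dotDr dotNr. Qed.

Lemma dot0l x : dot 0 x = 0.
Proof. by rewrite -[in LHS](scale0r x) dotZl mul0r. Qed.

Definition dotE := (dotDl, dotDr, dotBl, dotBr, dotZl, dotZr, dotNl, dotNr).

Lemma dot_ge0 x : 0 <= dot x x.
Proof. by apply: sumr_ge0 => i _; rewrite -expr2 sqr_ge0. Qed.

Lemma norm2_ge0 x : 0 <= norm2 x.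
Proof. exact: sqrtr_ge0. Qed.

Lemma sqr_norm2 x : norm2 x ^+ 2 = dot x x.
Proof. by rewrite sqr_sqrtr ?dot_ge0. Qed.

Lemma norm2N x : norm2 (- x) = norm2 x.
Proof. by rewrite /norm2 dotNl dotNr opprK. Qed.

Lemma norm2B x y : norm2 (x - y) = norm2 (y - x).
Proof. by rewrite -norm2N opprB. Qed.

Lemma norm2_0 : norm2 (0 : 'rV[R]_p) = 0.
Proof. by rewrite /norm2 dot0l sqrtr0. Qed.

Lemma norm2_eq0 x : norm2 x = 0 -> x = 0.
Proof.
move=> /eqP; rewrite sqrtr_eq0 => x0.
have /eqP : dot x x = 0 by apply/eqP; rewrite eq_le x0 dot_ge0.
rewrite psumr_eq0 => [/allP x0'|i _]; last by rewrite -expr2 sqr_ge0.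
apply/rowP => i; rewrite mxE; apply/eqP.
by have := x0' i (mem_index_enum i); rewrite -expr2 sqrf_eq0.
Qed.

Lemma norm2_le x y : (norm2 x <= norm2 y) = (dot x x <= dot y y).
Proof. by rewrite /norm2 ler_sqrt ?dot_ge0. Qed.

(** Young's inequality, from [|x - a y|^2 >= 0]. The weight stays free: it is [norm2 x / norm2 y]
    for Cauchy-Schwarz and a multiple of the step size in [exact_step_regret]. *)
Lemma dot_le_half a x y : 0 < a ->
  dot x y <= dot x x / (2 * a) + a / 2 * dot y y.
Proof.
move=> a0; have := dot_ge0 (x - a *: y); rewrite !dotE (dotC y x) => H.
have -> : dot x x / (2 * a) + a / 2 * dot y y =
  (dot x x + a ^+ 2 * dot y y) / (2 * a) by field; rewrite gt_eqF.
rewrite ler_pdivlMr ?mulr_gt0//; nra.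
Qed.

Lemma dot_le_norm2 x y : dot x y <= norm2 x * norm2 y.
Proof.
have [x0|x0] := eqVneq (norm2 x) 0.
  by rewrite x0 mul0r (norm2_eq0 x0) dot0l.
have [y0|y0] := eqVneq (norm2 y) 0.
  by rewrite y0 mulr0 (norm2_eq0 y0) dotC dot0l.
have a0 : 0 < norm2 x / norm2 y by rewrite divr_gt0// lt0r ?x0 ?y0 norm2_ge0.
apply: le_trans (dot_le_half x y a0) _; rewrite -!sqr_norm2 le_eqVlt.
by apply/orP; left; apply/eqP; field; rewrite x0 y0.
Qed.

Lemma norm2D x y : norm2 (x + y) <= norm2 x + norm2 y.
Proof.
rewrite -ler_sqr ?nnegrE ?addr_ge0 ?norm2_ge0// sqr_norm2 sqrrD !sqr_norm2.
by rewrite !dotE (dotC y x); have := dot_le_norm2 x y; lra.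
Qed.

Lemma norm2_dist_le x y z : `|norm2 (x - y) - norm2 (x - z)| <= norm2 (y - z).
Proof.
have H u v : norm2 (x - u) <= norm2 (x - v) + norm2 (u - v).
  by rewrite (norm2B u) -{1}(subrK v x) -addrA norm2D.
rewrite ler_norml; apply/andP; split; last by rewrite lerBlDl H.
by have := H z y; rewrite (norm2B z); lra.
Qed.

Lemma dotD_le x y : dot (x + y) (x + y) <= 2 * dot x x + 2 * dot y y.
Proof. by have := dot_ge0 (x - y); rewrite !dotE (dotC y x); lra. Qed.

Lemma abs_coord_le_norm2 x j : `|x 0 j| <= norm2 x.
Proof.
rewrite -sqrtr_sqr ler_sqrt ?dot_ge0// /dot (bigD1 j)//= -expr2 lerDl.
by apply: sumr_ge0 => i _; rewrite -expr2 sqr_ge0.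
Qed.

Lemma norm2_le_mx_norm x : norm2 x <= Num.sqrt p%:R * `|x|.
Proof.
rewrite -[`|x|]ger0_norm// -sqrtr_sqr -sqrtrM ?ler0n// ler_sqrt; last first.
  by rewrite mulr_ge0 ?ler0n ?sqr_ge0.
rewrite -[p in p%:R]card_ord -sum1_card natr_sum mulr_suml.
apply: ler_sum => j _; rewrite mul1r -expr2 -real_normK ?num_real//.
apply: lerXn2r; rewrite ?nnegrE//.
rewrite (mx_normrE x : `|x| = _).
by apply: (le_bigmax _ (fun ij : 'I_1 * 'I_p => `|x ij.1 ij.2|) (0, j)).
Qed.

(** The topology of ['rV[R]_p] comes from the sup norm, hence the factor [sqrt p]. The summand 1 in
    [c] keeps it positive when [K] or [p] vanishes. *)
Lemma lipschitz2_continuous (f : 'rV[R]_p -> R) K :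
  (forall x y, `|f x - f y| <= K * norm2 (x - y)) -> continuous f.
Proof.
move=> fK x; apply/(@cvgrPdist_le _ _ _ (nbhs x) (nbhs_filter x)) => e e0.
pose c := (`|K| * Num.sqrt p%:R + 1).
have c0 : 0 < c by rewrite ltr_wpDl// mulr_ge0// sqrtr_ge0.
near=> y.
apply: le_trans (fK _ _) _; apply: (@le_trans _ _ (c * `|x - y|)).
  apply: (@le_trans _ _ (`|K| * norm2 (x - y))).
    by rewrite ler_wpM2r ?norm2_ge0 ?ler_norm.
  rewrite /c mulrDl -mulrA ler_wpDr ?mul1r// ler_wpM2l//.
  exact: norm2_le_mx_norm.
rewrite -ler_pdivlMl//.
near: y; apply: cvgr_dist_le; last by rewrite mulr_gt0 ?invr_gt0.
exact: cvg_id.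
Unshelve. all: by end_near. Qed.

End DotProduct.

Section Projection.
Variables (R : realType) (p : nat) (C : set 'rV[R]_p).
Hypotheses (Ccl : closed C) (Cbd : bounded_set C) (Ccv : convex_set C).
Hypothesis C0 : C !=set0.
Implicit Types x y z : 'rV[R]_p.

(* The bare name proj is hidden by the projections of product topologies. *)
Lemma projP x : is_proj C x (Defs.proj C x).
Proof.
apply: xgetPex.
have [] := @EVT_min_rV R p (fun y => norm2 (x - y)) C C0.
- exact: bounded_closed_compact.
- apply: continuous_subspaceT; apply: (@lipschitz2_continuous _ _ _ 1) => y z.
  by rewrite mul1r norm2_dist_le.
- move=> c /[!inE] Cc cmin; exists c; split => // z Cz.
  by apply: cmin; rewrite inE.
Qed.

Lemma proj_in x : C (Defs.proj C x).
Proof. by case: (projP x). Qed.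

Lemma segment_in x y t : C x -> C y -> 0 <= t <= 1 -> C (x + t *: (y - x)).
Proof.
move=> Cx Cy /andP[t0 t1].
have := Ccv (Itv01 t0 t1) (mem_set Cy) (mem_set Cx); rewrite inE.
suff -> : x + t *: (y - x) = t *: y + (1 - t) *: x by [].
by apply/rowP => i; rewrite !mxE; ring.
Qed.

Lemma proj_obtuse x z : C z -> dot (x - Defs.proj C x) (z - Defs.proj C x) <= 0.
Proof.
move=> Cz; set y := Defs.proj C x; rewrite leNgt; apply/negP => H.
pose a := dot (x - y) (z - y); pose b := dot (z - y) (z - y).
have b0 : 0 <= b by exact: dot_ge0.
(* At [y + t (z - y)] the squared distance to [x] changes by [- 2 t a + t^2 b], negative once
   [t b < 2 a]. This [t] satisfies [t (a + b) = a], so [t <= 1] and [t b < a]. *)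
pose t := a / (a + b).
have ab : 0 < a + b by rewrite ltr_pwDl.
have t0 : 0 < t by rewrite divr_gt0.
have t1 : t <= 1 by rewrite ler_pdivrMr// mul1r lerDl.
have Ct : C (y + t *: (z - y)).
  by apply: segment_in => //; [exact: proj_in|rewrite ltW].
have [_ /(_ _ Ct)] := projP x; rewrite -/y norm2_le opprD addrA.
have expand u v : dot (u - t *: v) (u - t *: v) =
    dot u u - 2 * t * dot u v + t ^+ 2 * dot v v.
  by rewrite !dotE (dotC v u); ring.
rewrite expand -/a -/b => E.
have tb : t * (a + b) = a by rewrite /t divfK// gt_eqF.
have : 2 * a <= t * b by rewrite -(ler_pM2l t0); lra.
have : 0 < a := H. nra.
Qed.

(** With [y] the projection, [|x - z|^2 = |x - y|^2 + |y - z|^2 + 2 <x - y, y - z>], and the last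
    term is nonnegative by [proj_obtuse]. *)
Lemma proj_dist_le x z : C z ->
  dot (Defs.proj C x - z) (Defs.proj C x - z) <= dot (x - z) (x - z).
Proof.
move=> Cz; have := proj_obtuse x Cz; have := dot_ge0 (x - Defs.proj C x).
set y := Defs.proj C x; rewrite -(subrK y x) addrK.
rewrite -[x - y + y - z]addrA -(opprB y z) dotNr.
move: (x - y) (y - z) => u v; rewrite !dotE (dotC v u); lra.
Qed.

Lemma proj_id x : C x -> Defs.proj C x = x.
Proof.
move=> Cx; apply/eqP; rewrite -subr_eq0; apply/eqP/norm2_eq0/eqP.
rewrite sqrtr_eq0; apply: le_trans (proj_dist_le x Cx) _.
by rewrite subrr -sqr_norm2 norm2_0 expr0n.
Qed.

(** Adding two obtuse-angle inequalities gives [|a - b|^2 <= <x - y, a - b>]. The resulting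
    continuity of the projection serves to make the iterates measurable. *)
Lemma proj_nonexpansive x y : norm2 (Defs.proj C x - Defs.proj C y) <= norm2 (x - y).
Proof.
rewrite norm2_le.
have := proj_obtuse x (proj_in y); have := proj_obtuse y (proj_in x).
set a := Defs.proj C x; set b := Defs.proj C y.
rewrite -(opprB a b) dotNr => H1 H2.
have : dot (a - b) (a - b) <= dot (x - y) (a - b).
  have -> : x - y = (x - a) - (y - b) + (a - b).
    by apply/rowP => i; rewrite !mxE; ring.
  by rewrite (dotDl _ (a - b)) (dotBl (x - a)); lra.
have := @dot_le_half R p 1 (x - y) (a - b) ltr01; lra.
Qed.

Lemma norm2_le_diam2 x y : C x -> C y -> norm2 (x - y) <= diam2 C.
Proof.
move=> Cx Cy; apply: sup_upper_bound; last by exists x, y.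
split; first by exists (norm2 (x - y)), x, y.
have [M [_ MC]] := Cbd.
(* [bounded_set] gives every number above [M] as a bound, here [M + 1]. *)
exists (Num.sqrt p%:R * (2 * (M + 1))) => _ [u [v [Cu Cv ->]]].
apply: le_trans (norm2_le_mx_norm _) _; rewrite ler_wpM2l ?sqrtr_ge0//.
apply: le_trans (ler_normB _ _) _.
have {}MC := MC (M + 1) (ltr_pwDr ltr01 (lexx M)).
by have := MC u Cu; have := MC v Cv => /=; lra.
Qed.

Lemma diam2_ge0 : 0 <= diam2 C.
Proof.
by case: C0 => x Cx; apply: le_trans (norm2_le_diam2 Cx Cx); exact: norm2_ge0.
Qed.

End Projection.

(** * Borel measurability of row vectors *)

Section BorelRowVectors.
Variables (R : realType) (p : nat).

(** An open set is the union of the boxes inside it with rational centre and radius [1 / (m + 1)].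
    These are countably many, and the preimage of each is a finite intersection of conditions on
    coordinates. *)
Lemma measurable_rV d (T : measurableType d) (X : T -> 'rV[R]_p) :
  (forall j, measurable_fun setT (fun w => X w 0 j)) ->
  measurable_fun setT (X : T -> Borel_rV R p).
Proof.
move=> mX; apply: (@measurability _ _ T (Borel_rV R p) setT X (@open 'rV[R]_p)) => //.
move=> _ [U oU <-]; rewrite setTI.
pose box (k : {ffun 'I_p -> rat} * nat) : set 'rV[R]_p :=
  [set v | forall j, `|v 0 j - ratr (k.1 j)| < k.2.+1%:R^-1].
rewrite (_ : X @^-1` U =
  \bigcup_k (if `[< box k `<=` U >] then X @^-1` box k else set0)); last first.
  apply/seteqP; split => [w /= Uw|w [k _]]; last by case: asboolP => // kU /kU.
  move: oU; rewrite openE => /(_ _ Uw) /nbhs_ballP[e /= e0 eU].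
  (* All points of a box of radius [1 / (m + 1)] containing [X w] are within [2 / (m + 1)] of it in
     the sup norm. *)
  have [m me] : exists m : nat, 2 * m.+1%:R^-1 < e.
    exists (Num.truncn (2 / e)).
    by rewrite ltr_pdivrMr ?ltr0n// mulrC -ltr_pdivrMr// truncnS_gt.
  have m0 : (0 : R) < m.+1%:R^-1 by rewrite invr_gt0 ltr0n.
  have /choice[q qP] : forall j, exists q : rat, `|X w 0 j - ratr q| < m.+1%:R^-1.
    move=> j; have xm : X w 0 j - m.+1%:R^-1 < X w 0 j + m.+1%:R^-1.
      by rewrite ltrBlDr -addrA ltrDl addr_gt0.
    have [q] := rat_in_itvoo xm.
    rewrite in_itv/= -ltr_distl => qX; exists q; rewrite distrC//.
  have bw : box ([ffun j => q j], m) (X w) by move=> j; rewrite /= ffunE.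
  exists ([ffun j => q j], m) => //; case: asboolP => //; case.
  move=> v bv; apply: eU; split => // i j; rewrite !ord1 /ball/=.
  have := bv j; rewrite /= ffunE => vq.
  apply: le_lt_trans (ler_distD (ratr (q j)) _ _) (lt_trans _ me).
  by rewrite mulr_natl mulr2n ltrD// distrC.
apply: countable_bigcupT_measurable => [|k]; first exact: countableP.
case: asboolP => _; last exact: measurable0.
rewrite (_ : _ @^-1` _ = \bigcap_(j in [set: 'I_p])
  (fun w => X w 0 j) @^-1` [set r | `|r - ratr (k.1 j)| < k.2.+1%:R^-1]).
  apply: fin_bigcap_measurable => //= j _; rewrite -[X in measurable X]setTI.
  apply: mX => //; rewrite (_ : [set _ | _] =
    `](ratr (k.1 j) - k.2.+1%:R^-1), (ratr (k.1 j) + k.2.+1%:R^-1)[%classic).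
    exact: measurable_itv.
  by apply/seteqP; split => r; rewrite /= in_itv/= ltr_distl.
by apply/seteqP; split => w /= bw; [move=> j _; exact: bw|move=> j; exact: bw].
Qed.

Lemma continuous_Borel_rV_measurable (f : 'rV[R]_p -> R) : continuous f ->
  measurable_fun setT (f : Borel_rV R p -> R).
Proof.
move=> /continuousP cf; apply: (measurability (@RGenOpens.G R)).
  exact: RGenOpens.measurableE.
move=> _ [U [a [b ->]] <-]; rewrite setTI.
by apply: sub_sigma_algebra; apply: cf; exact: interval_open.
Qed.

Lemma measurable_continuous_rV d (T : measurableType d) (X : T -> 'rV[R]_p)
    (f : 'rV[R]_p -> R) : continuous f ->
  (forall j, measurable_fun setT (fun w => X w 0 j)) ->
  measurable_fun setT (fun w => f (X w)).
Proof.
move=> cf mX; exact: (measurableT_comp (continuous_Borel_rV_measurable cf) (measurable_rV mX)).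
Qed.

Lemma closed_Borel_rV_measurable (C : set 'rV[R]_p) : closed C ->
  measurable (C : set (Borel_rV R p)).
Proof.
move=> cC; rewrite -[C]setCK; apply: measurableC.
by apply: sub_sigma_algebra; rewrite openC.
Qed.

(** [g] is measurable on [C] alone, so the composition needs [C] to be Borel and to contain the
    values of [X]. *)
Lemma measurable_Borel_comp d (T : measurableType d) (C : set 'rV[R]_p)
    (X : T -> 'rV[R]_p) (g : 'rV[R]_p -> 'rV[R]_p) j : closed C ->
  measurable_fun (C : set (Borel_rV R p)) (g : Borel_rV R p -> Borel_rV R p) ->
  (forall w, C (X w)) ->
  (forall i, measurable_fun setT (fun w => X w 0 i)) ->
  measurable_fun setT (fun w => g (X w) 0 j).
Proof.
move=> cC mg CX mX.
have mcoord := continuous_Borel_rV_measurable (@coord_continuous R 1 p 0 j).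
apply: (measurableT_comp mcoord).
apply: (measurable_comp (closed_Borel_rV_measurable cC) _ mg (measurable_rV mX)).
by move=> _ [w _ <-]; exact: CX.
Qed.

End BorelRowVectors.

(** * Independence *)

Section Independence.
Context {d : measure_display} {Omega : measurableType d} {R : realType}.
Variable P : probability Omega R.

(** A pi-system that generates the joint sigma-algebra of the classes with index in [S]. *)
Definition cylinders (I : finType) (F : I -> set (set Omega)) (S : {set I}) :=
  [set X | exists2 E : I -> set Omega, (forall i, i \in S -> F i (E i)) &
           X = \bigcap_(i in [set` S]) E i].

Variables (I : finType) (F : I -> set (set Omega)) (S : {set I}).
Hypothesis FI : forall i, setI_closed (F i).
Hypothesis FT : forall i, F i setT.
Hypothesis Fm : forall i, F i `<=` measurable.

Lemma cylinders_measurable : cylinders F S `<=` measurable.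
Proof.
move=> _ [E FE ->]; apply: fin_bigcap_measurable => //= i iS.
by apply: Fm; exact: FE.
Qed.

Lemma cylindersI : setI_closed (cylinders F S).
Proof.
move=> _ _ [E FE ->] [E' FE' ->]; exists (fun i => E i `&` E' i).
  by move=> i iS; apply: FI; [exact: FE|exact: FE'].
by rewrite bigcapI.
Qed.

Lemma cylindersT : cylinders F S setT.
Proof. by exists (fun=> setT) => [i _|]; [exact: FT|rewrite bigcapT]. Qed.

Lemma cylinders_proj i A : i \in S -> F i A -> cylinders F S A.
Proof.
move=> iS FA; exists (fun j => if j == i then A else setT).
  by move=> j jS; case: eqP => [->|_].
apply/seteqP; split => [w Aw j _|w /(_ i iS)]; first by case: eqP.
by rewrite eqxx.
Qed.

Lemma sigma_cylinders_measurable : <<s cylinders F S >> `<=` measurable.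
Proof.
apply: smallest_sub; first exact: sigma_algebra_measurable.
exact: cylinders_measurable.
Qed.

(** For fixed [B], the probability of the intersection with [B] and [P B] times [P] are finite
    measures that agree on the pi-system of cylinders, hence on the sigma-algebra it generates. *)
Lemma sigma_cylinders_independent k A B :
  independent_classes P F -> k \notin S ->
  <<s cylinders F S >> A -> F k B -> P (A `&` B) = (P A * P B)%E.
Proof.
move=> indF kS sA FB.
have mB : measurable B by exact: Fm FB.
have PB0 : 0 <= fine (P B) by rewrite fine_ge0.
have PBE : P B = (fine (P B))%:E by rewrite fineK// fin_num_measure.
suff : mrestr P mB A = mscale (NngNum PB0) P A.
  by rewrite /mscale/= /mrestr => ->; rewrite muleC [in RHS]PBE.
apply: (g_sigma_algebra_measure_unique (cylinders F S) _ (fun=> setT)) => //.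
- exact: cylinders_measurable.
- by move=> _; exact: cylindersT.
- by rewrite bigcup_const//; exists 0%N.
- exact: cylindersI.
- move=> _ [E FE ->].
  change (P ((\bigcap_(i in [set` S]) E i) `&` B) =
    (fine (P B))%:E * P (\bigcap_(i in [set` S]) E i))%E.
  rewrite -PBE (indF S E FE).
  (* Independence of the family enlarged by [B] at index [k] factors out [P B]. *)
  pose E' i := if i == k then B else E i.
  have E'E i : i \in S -> E' i = E i.
    by rewrite /E'; case: eqVneq => // ->; rewrite (negPf kS).
  have FE' i : i \in k |: S -> F i (E' i).
    by rewrite /E' in_setU1; case: eqVneq => [->//|_ /=]; exact: FE.
  have := indF (k |: S) E' FE'; rewrite big_setU1//= {2}/E' eqxx.
  rewrite (eq_bigr (fun i => P (E i))); last by move=> i /E'E ->.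
  move=> <-; congr (P _); apply/seteqP; split => [w [Ew Bw] i /=|w E'w].
    by rewrite in_setU1 /E'; case: eqVneq => //= _ iS; exact: Ew.
  split; last by have := E'w k; rewrite /E' eqxx; apply; rewrite /= setU11.
  by move=> i /= iS; have := E'w i; rewrite E'E//; apply; rewrite /= in_setU1 iS orbT.
- move=> _; change (P (setT `&` B) < +oo)%E.
  by rewrite setTI (le_lt_trans (probability_le1 _ _)) ?ltry.
Qed.
End Independence.

(** By independence the law of the pair is the product of the laws, and Fubini splits the integral.
    Boundedness of [X] makes the product integrable. *)
Lemma Rintegral_indep_mul d (Omega : measurableType d) (R : realType)
    (P : probability Omega R) (X Y : Omega -> R) :
  (forall A B, measurable A -> measurable B ->
    P (X @^-1` A `&` Y @^-1` B) = (P (X @^-1` A) * P (Y @^-1` B))%E) ->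
  measurable_fun setT X -> (exists M : R, forall w, `|X w| <= M) ->
  P.-integrable setT (EFin \o Y) ->
  Rintegral P setT (fun w => X w * Y w) =
  Rintegral P setT X * Rintegral P setT Y.
Proof.
move=> XY mX [M XM] iY.
have mY : measurable_fun setT Y by apply/measurable_EFinP; exact: measurable_int iY.
pose Z w := (X w, Y w).
have mZ : measurable_fun setT Z by exact/measurable_fun_pair.
pose rX : {mfun Omega >-> R} := HB.pack X (isMeasurableFun.Build _ _ _ _ X mX).
pose rY : {mfun Omega >-> R} := HB.pack Y (isMeasurableFun.Build _ _ _ _ Y mY).
pose rZ : {mfun Omega >-> (R * R)%type} := HB.pack Z (isMeasurableFun.Build _ _ _ _ Z mZ).
pose f (z : R * R) : \bar R := (z.1 * z.2)%:E.
have mf : measurable_fun setT f.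
  by apply/measurable_EFinP; apply: measurable_funM.
have bX : [bounded X w | w in setT].
  by exists M; split; [exact: num_real|move=> x Mx w _; exact: le_trans (XM w) (ltW Mx)].
have iX : P.-integrable setT (EFin \o X).
  apply: measurable_bounded_integrable => //.
  by rewrite (le_lt_trans (probability_le1 P _)) ?ltry.
have iXY : P.-integrable setT (f \o Z).
  exact: (integrableMr _ mX bX iY).
have dZE A : measurable A ->
    distribution P rZ A = (distribution P rX \x distribution P rY)%E A.
  by move=> mA; apply/esym/product_measure_unique => // B C mB mC; rewrite -XY.
have E : (\int[P]_w (X w * Y w)%:E =
   \int[distribution P rX \x distribution P rY]_z f z)%E.
  transitivity (\int[distribution P rZ]_z f z)%E.
    by rewrite integral_distribution.
  by apply: eq_measure_integral => A mA _; exact: dZE.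
(* Integrability on the product space is carried over from [Omega] through the law of the pair. *)
have if' : (distribution P rX \x distribution P rY)%E.-integrable setT f.
  apply/integrableP; split => //.
  rewrite (eq_measure_integral (distribution P rZ)); last first.
    by move=> A mA _; exact/esym/dZE.
  rewrite ge0_integral_distribution//; last exact: measurableT_comp.
  by case/integrableP : iXY.
rewrite /Rintegral E -integral12_prod_meas1//.
have iYd : (distribution P rY).-integrable setT (EFin : R -> \bar R).
  by apply: integrable_pushforward => //; exact: EFin_measurable.
have iXd : (distribution P rX).-integrable setT (EFin : R -> \bar R).
  by apply: integrable_pushforward => //; exact: EFin_measurable.
have EY : (\int[distribution P rY]_y y%:E = \int[P]_w (Y w)%:E)%E.
  by rewrite (integral_distribution (X := rY)).
have EX : (\int[distribution P rX]_y y%:E = \int[P]_w (X w)%:E)%E.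
  by rewrite (integral_distribution (X := rX)).
rewrite -fineM; try exact: integrable_fin_num.
congr fine; rewrite -EY -EX.
transitivity (\int[distribution P rX]_x (x%:E * \int[distribution P rY]_y y%:E))%E.
  apply: eq_integral => x _; rewrite /fubini_F -integralZl//.
rewrite EY -(fineK (integrable_fin_num measurableT iY)) integralZr//.
Qed.

(** * Centered Gaussian variables *)

Section GaussianMoments.
Variable R : realType.
Local Notation mu := (@lebesgue_measure R).

Let opp (x : measurableTypeR R) : measurableTypeR R := - x.

Let measurable_opp : measurable_fun setT opp.
Proof. exact: oppr_measurable. Qed.

Let mu_opp : {measure set (measurableTypeR R) -> \bar R} :=
  measure_function_pushforward__canonical__measure_function_Measure
    (@lebesgue_measure R) measurable_opp.

(** Reflection turns []a, b]] into [[- b, - a[], of the same length, and Lebesgue measure is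
    determined by the half-open intervals. *)
Lemma lebesgue_measure_opp (A : set (measurableTypeR R)) : measurable A ->
  mu A = mu_opp A.
Proof.
apply: lebesgue_measure_unique => _ [[a b] _ <-].
rewrite /mu_opp/= /pushforward (_ : opp @^-1` _ = `[- b, - a[%classic).
  by rewrite !lebesgue_measure_itv/= !lte_fin ltrN2 opprK addrC.
by apply/seteqP; split => x /=; rewrite !in_itv/= /opp ltrNr lerNl andbC.
Qed.

Lemma normal_prob_opp (s : R) (A : set (measurableTypeR R)) : s != 0 ->
  measurable A -> normal_prob 0 s (-%R @^-1` A) = normal_prob 0 s A.
Proof.
move=> s0 mA; rewrite /normal_prob.
have even x : normal_pdf 0 s (opp x) = normal_pdf 0 s x.
  by rewrite normal_pdfE// /normal_fun !subr0 sqrrN.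
rewrite [RHS](eq_measure_integral mu_opp); last first.
  by move=> B mB _; exact: lebesgue_measure_opp.
rewrite ge0_integral_pushforward//.
- by apply: eq_integral => x _; rewrite /= even.
- by apply/measurable_EFinP/measurable_funTS; exact: measurable_normal_pdf.
- by move=> x _; rewrite lee_fin normal_pdf_ge0.
Qed.

(** The Radon-Nikodym derivative of [normal_prob] agrees almost everywhere with [normal_pdf], since
    both have the same integral over every measurable set. *)
Lemma integral_normal_prob (s : R) (f : R -> R) : (forall x, 0 <= f x) ->
  measurable_fun setT f ->
  (\int[normal_prob 0 s]_x (f x)%:E = \int[mu]_x (f x * normal_pdf 0 s x)%:E)%E.
Proof.
move=> f0 mf.
rewrite -(Radon_Nikodym_SigmaFinite.change_of_variables (normal_prob_dominates 0 s))//;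
  last exact/measurable_EFinP.
apply: ae_eq_integral => //.
- apply: emeasurable_funM; first exact/measurable_EFinP.
  exact: measurable_int (Radon_Nikodym_SigmaFinite.f_integrable (normal_prob_dominates 0 s)).
- by apply/measurable_EFinP/measurable_funM => //; exact: measurable_normal_pdf.
- under [X in ae_eq _ _ _ X]eq_fun do rewrite EFinM.
  apply: ae_eqe_mul2l; apply: integral_ae_eq => //.
  + exact: Radon_Nikodym_SigmaFinite.f_integrable (normal_prob_dominates 0 s).
  + by apply/measurable_EFinP; exact: measurable_normal_pdf.
  + move=> E _ mE.
    by rewrite -(Radon_Nikodym_SigmaFinite.f_integral (normal_prob_dominates 0 s)).
Qed.

(* A constant worse than 1 is harmless here, and it avoids integrating by parts:
   x^2 exp(-x^2/(2 s^2)) is at most 4 s^2 exp(-x^2/(4 s^2)), a multiple of the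
   density of variance 2 s^2. *)
Lemma normal_second_moment (s : R) : 0 < s ->
  (\int[normal_prob 0 s]_x (x ^+ 2)%:E <= (8 * s ^+ 2)%:E)%E.
Proof.
move=> s0.
rewrite integral_normal_prob; first last.
- exact: measurable_funX.
- by move=> x; exact: sqr_ge0.
pose s' := Num.sqrt 2 * s.
have s'0 : 0 < s' by rewrite mulr_gt0// sqrtr_gt0.
have le_pdf x : x ^+ 2 * normal_pdf 0 s x <= 8 * s ^+ 2 * normal_pdf 0 s' x.
  rewrite !normal_pdfE ?gt_eqF// /normal_fun !subr0.
  have s'2 : s' ^+ 2 = 2 * s ^+ 2 by rewrite exprMn sqr_sqrtr.
  have peak : normal_peak s = Num.sqrt 2 * normal_peak s'.
    rewrite /normal_peak s'2.
    have -> : 2 * s ^+ 2 * pi *+ 2 = 2 * (s ^+ 2 * pi *+ 2) by ring.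
    rewrite (sqrtrM (s ^+ 2 * pi *+ 2))// invfM mulrA divff ?mul1r//.
  have sqrt2 : Num.sqrt 2 <= 2 :> R.
    by rewrite -[leRHS]ger0_norm// -sqrtr_sqr ler_sqrt ?exprn_ge0//; lra.
  (* The exponent is [- 2 u] for variance [s^2] and [- u] for variance [2 s^2]. The spare factor
     [expR (- u)] absorbs [u], the peaks differ by [sqrt 2], and [4 sqrt 2 <= 8]. *)
  pose u := x ^+ 2 / (4 * s ^+ 2).
  have -> : - x ^+ 2 / (s ^+ 2 *+ 2) = - u + - u.
    by rewrite /u; field; rewrite gt_eqF.
  have -> : - x ^+ 2 / (s' ^+ 2 *+ 2) = - u.
    by rewrite /u s'2; field; rewrite gt_eqF.
  have -> : x ^+ 2 = 4 * s ^+ 2 * u by rewrite /u; field; rewrite gt_eqF.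
  have uu : u * expR (- u) <= 1.
    by rewrite expRN ler_pdivrMr ?expR_gt0// mul1r; have := expR_ge1Dx u; lra.
  rewrite expRD peak.
  have -> : 4 * s ^+ 2 * u * (Num.sqrt 2 * normal_peak s' * (expR (- u) * expR (- u))) =
    (4 * s ^+ 2 * normal_peak s' * expR (- u)) * (Num.sqrt 2 * (u * expR (- u))) by ring.
  have -> : 8 * s ^+ 2 * (normal_peak s' * expR (- u)) =
    (4 * s ^+ 2 * normal_peak s' * expR (- u)) * 2 by ring.
  rewrite ler_wpM2l ?mulr_ge0 ?sqr_ge0 ?normal_peak_ge0 ?expR_ge0 ?(ltW s0)//.
  by apply: (le_trans _ sqrt2); rewrite ler_piMr ?sqrtr_ge0.
apply: (@le_trans _ _ (\int[mu]_x ((8 * s ^+ 2)%:E * (normal_pdf 0 s' x)%:E))%E).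
  apply: ge0_le_integral => //.
  - by move=> x _; rewrite lee_fin mulr_ge0 ?sqr_ge0 ?normal_pdf_ge0.
  - apply/measurable_EFinP/measurable_funM; first exact: measurable_funX.
    exact: measurable_normal_pdf.
  - by apply/measurable_EFinP/measurable_funM => //; exact: measurable_normal_pdf.
  - by move=> x _; rewrite -EFinM lee_fin le_pdf.
rewrite (integralZl measurableT (integrable_normal_pdf 0 s')).
by rewrite integral_normal_pdf mule1.
Qed.

Lemma centered_gaussian_opp (s : R) (A : set (measurableTypeR R)) : measurable A ->
  centered_gaussian s (-%R @^-1` A) = centered_gaussian s A.
Proof.
rewrite /centered_gaussian; case: eqVneq => s0 mA; last exact: normal_prob_opp.
by rewrite !diracE; congr (_%:E); congr (_%:R); congr nat_of_bool;
  apply/idP/idP; rewrite !inE /= oppr0.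
Qed.

Variables (d : measure_display) (Omega : measurableType d).
Variables (P : probability Omega R) (X : {RV P >-> R}) (s : R).

Let mX : measurable_fun setT (X : Omega -> measurableTypeR R).
Proof.
have h : measurable_fun setT (X : Omega -> R) by exact: measurable_funPT.
exact: h.
Qed.

(** The same variable, with the codomain on which the Gaussian laws are measures. *)
Let X' : {mfun Omega >-> measurableTypeR R} :=
  HB.pack (X : Omega -> measurableTypeR R)
    (isMeasurableFun.Build _ _ _ (measurableTypeR R) _ mX).

Hypothesis s0 : 0 <= s.
Hypothesis Xs : forall A, measurable A -> distribution P X A = centered_gaussian s A.

Lemma gaussian_second_moment : (\int[P]_w (X w ^+ 2)%:E <= (8 * s ^+ 2)%:E)%E.
Proof.
rewrite -(@ge0_integral_distribution _ _ _ _ _ P X' (fun x => (x ^+ 2)%:E)); first last.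
- by move=> x; rewrite lee_fin sqr_ge0.
- by apply/measurable_EFinP; exact: measurable_funX.
have [s00|sn0] := eqVneq s 0.
  have -> : (\int[distribution P X']_x (x ^+ 2)%:E =
      \int[\d_(0%R : measurableTypeR R)]_x (x ^+ 2)%:E)%E.
    apply: eq_measure_integral => A mA _.
    transitivity (centered_gaussian s A); first exact: Xs.
    by rewrite /centered_gaussian s00 eqxx.
  rewrite integral_dirac//; last by apply/measurable_EFinP; exact: measurable_funX.
  by rewrite diracT mul1e s00 !expr0n mulr0.
have -> : (\int[distribution P X']_x (x ^+ 2)%:E =
    \int[normal_prob 0 s]_x (x ^+ 2)%:E)%E.
  apply: eq_measure_integral => A mA _.
  transitivity (centered_gaussian s A); first exact: Xs.
  by rewrite /centered_gaussian (negPf sn0).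
by apply: normal_second_moment; rewrite lt0r sn0.
Qed.

Lemma gaussian_sqr_integrable : P.-integrable setT (fun w => (X w ^+ 2)%:E).
Proof.
apply/integrableP; split; first by apply/measurable_EFinP; exact: measurable_funX.
under eq_integral do rewrite gee0_abs ?lee_fin ?sqr_ge0//.
exact: le_lt_trans gaussian_second_moment (ltry _).
Qed.

Lemma gaussian_integrable : P.-integrable setT (EFin \o X).
Proof.
apply: (@le_integrable _ _ _ P setT measurableT _ (fun w => (1 + X w ^+ 2)%:E)).
- exact/measurable_EFinP.
- move=> w _; rewrite lee_fin [leRHS]ger0_norm ?addr_ge0 ?sqr_ge0//.
  rewrite -[X w ^+ 2]real_normK ?num_real//.
  by have := sqr_ge0 (`|X w| - 1); nra.
- under eq_fun do rewrite EFinD.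
  apply: integrableD => //; last exact: gaussian_sqr_integrable.
  exact: finite_measure_integrable_cst.
Qed.

(** By symmetry of the law, [X] and [- X] have the same expectation. *)
Lemma gaussian_mean0 : Rintegral P setT X = 0.
Proof.
pose NX : {mfun Omega >-> R} := HB.pack (\- X)
  (isMeasurableFun.Build _ _ _ _ (\- X) (measurable_funN (measurable_funPT X))).
have iNX : P.-integrable setT (EFin \o NX).
  apply: (eq_integrable measurableT (-%E \o (EFin \o X))) => //.
  exact: integrableN gaussian_integrable.
have E : (\int[distribution P NX]_x x%:E = \int[distribution P X]_x x%:E)%E.
  apply: eq_measure_integral => A mA _.
  have mA' : measurable (-%R @^-1` A : set R).
    by rewrite -[X in measurable X]setTI; exact: oppr_measurable.
  transitivity (centered_gaussian s (-%R @^-1` A)); first exact: (Xs mA').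
  transitivity (centered_gaussian s A); first exact: centered_gaussian_opp.
  exact/esym/Xs.
rewrite !integral_distribution// in E; try exact: EFin_measurable;
  last exact: gaussian_integrable.
have : Rintegral P setT (fun w => -1 * X w) = Rintegral P setT X.
  rewrite /Rintegral -E; congr fine; apply: eq_integral => w _.
  by rewrite /= mulN1r.
rewrite RintegralZl//; last exact: gaussian_integrable.
by lra.
Qed.
End GaussianMoments.

(** * The draws and the iterates *)

Section Iterates.
Variables (R : realType) (p n : nat) (U : Type) (C : set 'rV[R]_p).
Variables (g : 'rV[R]_p -> U -> 'rV[R]_p) (D : 'I_n -> U) (eta : nat -> R).
Variable theta1 : 'rV[R]_p.
Hypotheses (Ccl : closed C) (Cbd : bounded_set C) (Ccv : convex_set C).
Hypothesis C1 : C theta1.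

Local Notation iter pick b := (noise_gd_iter C g D eta theta1 pick b).

Lemma noise_gd_iter_in pick b k : C (iter pick b k).
Proof. by case: k => [//|k]; apply: proj_in => //; exists theta1. Qed.

Variables (disp : measure_display) (M : measurableType disp).
Variables (pick : nat -> M -> 'I_n) (b : nat -> 'I_p -> M -> R).
Hypothesis mg : forall i,
  measurable_fun (C : set (Borel_rV R p)) (g ^~ (D i) : Borel_rV R p -> Borel_rV R p).

(** The space [M] is arbitrary, so that this applies to the sample space carrying the sigma-algebra
    of the past. *)
Lemma noise_gd_iter_measurable k :
  (forall t i, (t < k)%N -> measurable (pick t @^-1` [set i])) ->
  (forall t j, (t < k)%N -> measurable_fun setT (b t j)) ->
  forall j, measurable_fun setT
    (fun w => iter (pick ^~ w) (fun t => \row_j b t j w) k 0 j).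
Proof.
elim: k => [|k IH] mp mb j /=; first exact: measurable_cst.
have {}IH i : measurable_fun setT
    (fun w => iter (pick ^~ w) (fun t => \row_j b t j w) k 0 i).
  by apply: IH => t l tk; [apply: mp|apply: mb]; exact: ltnW.
have mdraw l : measurable_fun setT (fun w =>
   g (iter (pick ^~ w) (fun t => \row_j b t j w) k) (D (pick k w)) 0 l).
  (* There is no sigma-algebra on [U]; the sampled gradient is split according to the finitely many
     values of [pick k]. *)
  rewrite (_ : (fun _ => _) = fun w => \sum_(i < n) \1_(pick k @^-1` [set i]) w *
      g (iter (pick ^~ w) (fun t => \row_j b t j w) k) (D i) 0 l); last first.
    apply/funext => w; rewrite (bigD1 (pick k w))//= big1 => [|i ne].
      by rewrite indicE mem_set// mul1r addr0.
    rewrite indicE memNset ?mul0r// => /= E.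
    by rewrite E eqxx in ne.
  apply: measurable_sum => i; apply: measurable_funM.
    by apply: measurable_indic; exact: mp.
  apply: (measurable_Borel_comp _ Ccl (mg i)) => // w; exact: noise_gd_iter_in.
have C0 : C !=set0 by exists theta1.
apply: (measurable_continuous_rV (f := fun x => Defs.proj C x 0 j)).
  apply: (@lipschitz2_continuous _ _ _ 1) => x y; rewrite mul1r.
  apply: le_trans (proj_nonexpansive Ccl Cbd Ccv C0 x y).
  by have := abs_coord_le_norm2 (Defs.proj C x - Defs.proj C y) j; rewrite !mxE.
move=> l.
under [X in measurable_fun _ X]eq_fun do rewrite !mxE.
apply: measurable_funB => //; apply: measurable_funM => //.
apply: measurable_funD; last exact: mb.
exact: measurable_funM.
Qed.

End Iterates.

(** * The sigma-algebra of the past and its independence of the next draw *)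

Section Draws.
Context {d : measure_display} {Omega : measurableType d} {R : realType}.
Variables (P : probability Omega R) (n p N : nat) (s : R).
Variables (pick : nat -> Omega -> 'I_n) (b : nat -> 'I_p -> {RV P >-> R}).
Hypothesis s0 : 0 <= s.
Hypothesis draws : noise_gd_draws N s pick b.

Local Notation F := (@draw_events d Omega R P n p N pick b).

Lemma draw_eventsI k : setI_closed (F k).
Proof.
by case: k => [t|[t j]] _ _ [A mA <-] [B mB <-]; exists (A `&` B);
  rewrite ?preimage_setI ?setTI//; exact: measurableI.
Qed.

Lemma draw_eventsT k : F k setT.
Proof. by case: k => [t|[t j]]; exists setT => //; rewrite preimage_setT setTI. Qed.

Lemma draw_events_measurable k : F k `<=` measurable.
Proof.
have [mp _ _ _] := draws.
case: k => [t|[t j]] _ [A mA <-]; rewrite setTI; last exact: measurable_funPTI.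
rewrite (_ : _ @^-1` _ = \bigcup_(i in A) (pick t @^-1` [set i])).
  by apply: fin_bigcup_measurable => // i _; exact: mp.
apply/seteqP; split => [w Aw|w [i Ai /= ->]]//; by exists (pick t w).
Qed.

Definition past (k : nat) : {set 'I_N + 'I_N * 'I_p} :=
  finset (fun x : 'I_N + 'I_N * 'I_p =>
    match x with inl t => (t < k)%N | inr tj => (tj.1 < k)%N end).

(* The same sample space, with the sigma-algebra generated by the draws of the
   first k steps: measurability on it expresses dependence on the past only. *)
Definition past_space k : measurableType _ := g_sigma_algebraType (cylinders F (past k)).

Lemma past_measurable_pick k t i : (t < k <= N)%N ->
  measurable (pick t @^-1` [set i] : set (past_space k)).
Proof.
move=> /andP[tk kN]; apply: sub_sigma_algebra.
pose t' := Ordinal (leq_trans tk kN).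
apply: (@cylinders_proj _ _ _ F _ draw_eventsT (inl t')); first by rewrite inE.
by exists [set i] => //; rewrite setTI.
Qed.

Lemma past_measurable_noise k t j : (t < k <= N)%N ->
  measurable_fun setT (b t j : past_space k -> R).
Proof.
move=> /andP[tk kN] _ A mA; apply: sub_sigma_algebra.
pose t' := Ordinal (leq_trans tk kN).
apply: (@cylinders_proj _ _ _ F _ draw_eventsT (inr (t', j))); first by rewrite inE.
by exists A.
Qed.

Lemma past_measurable_fun k (f : Omega -> R) :
  measurable_fun setT (f : past_space k -> R) -> measurable_fun setT f.
Proof.
move=> mf _ A mA; apply: (sigma_cylinders_measurable draw_events_measurable).
exact: mf.
Qed.

Lemma Rintegral_past_mul k x (H Z : Omega -> R) : x \notin past k ->
  measurable_fun setT (H : past_space k -> R) ->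
  (exists M : R, forall w, `|H w| <= M) ->
  (forall A, measurable A -> F x (Z @^-1` A)) ->
  P.-integrable setT (EFin \o Z) ->
  Rintegral P setT (fun w => H w * Z w) =
  Rintegral P setT H * Rintegral P setT Z.
Proof.
move=> xk mH bH FZ iZ; apply: Rintegral_indep_mul => //; last first.
  exact: past_measurable_fun mH.
move=> A B mA mB; have [_ _ _ ind] := draws.
apply: (@sigma_cylinders_independent _ _ _ P _ F (past k) _ _ _ x) => //.
- exact: draw_eventsI.
- exact: draw_eventsT.
- exact: draw_events_measurable.
- by rewrite -[X in <<s _ >> X]setTI; exact: mH.
- exact: FZ.
Qed.

(** Unbiasedness of the sampled gradient, one entry at a time: [H] will be the inner product of the
    gradient for entry [i] with a displacement. *)
Lemma Rintegral_past_pick k i (H : Omega -> R) : (k < N)%N ->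
  measurable_fun setT (H : past_space k -> R) ->
  (exists M : R, forall w, `|H w| <= M) ->
  Rintegral P setT (fun w => H w * (pick k w == i)%:R) =
  n%:R^-1 * Rintegral P setT H.
Proof.
move=> kN mH bH; have [mp Pp _ _] := draws.
have ZE : (fun w => (pick k w == i)%:R : R) = \1_(pick k @^-1` [set i]).
  apply/funext => w; rewrite indicE; congr (_%:R); congr nat_of_bool.
  by apply/eqP/idP; rewrite inE.
rewrite (@Rintegral_past_mul k (inl (Ordinal kN)))//.
- rewrite mulrC; congr (_ * _); rewrite ZE /Rintegral integral_indic//; last exact: mp.
  by rewrite setIT; exact: congr1 (Pp k i kN).
- by rewrite inE ltnn.
- by move=> A _; exists [set j | A (j == i)%:R]; rewrite ?setTI.
- by rewrite ZE; apply: integrable_indic => //; exact: mp.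
Qed.

Lemma Rintegral_past_noise k j (H : Omega -> R) : (k < N)%N ->
  measurable_fun setT (H : past_space k -> R) ->
  (exists M : R, forall w, `|H w| <= M) ->
  Rintegral P setT (fun w => H w * b k j w) = 0.
Proof.
move=> kN mH bH; have [_ _ Pb _] := draws.
have bk A := Pb k j A kN.
rewrite (@Rintegral_past_mul k (inr (Ordinal kN, j)))//.
- by rewrite (gaussian_mean0 s0 bk) mulr0.
- by rewrite inE ltnn.
- by move=> A mA; exists A => //; rewrite setTI.
- exact: gaussian_integrable s0 bk.
Qed.

End Draws.

(** * One noisy gradient step *)

Section BoundedMeasurable.
Context {d : measure_display} {T : measurableType d} {R : realType}.
Implicit Types f h : T -> R.

(** The functions of the iterates that occur are of this kind, because [C] is bounded. Such factors
    keep the unbounded Gaussian noise integrable and meet the hypotheses of the factorisation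
    lemmas. *)
Definition bounded_measurable f :=
  measurable_fun setT f /\ exists M : R, forall w, `|f w| <= M.

Lemma bounded_measurable_cst (r : R) : bounded_measurable (fun=> r).
Proof. by split; [exact: measurable_cst|exists `|r|]. Qed.

Lemma bounded_measurableD f h :
  bounded_measurable f -> bounded_measurable h ->
  bounded_measurable (fun w => f w + h w).
Proof.
move=> [mf [M fM]] [mh [N hN]]; split; first exact: measurable_funD.
by exists (M + N) => w; apply: le_trans (ler_normD _ _) _; exact: lerD.
Qed.

Lemma bounded_measurableM f h :
  bounded_measurable f -> bounded_measurable h ->
  bounded_measurable (fun w => f w * h w).
Proof.
move=> [mf [M fM]] [mh [N hN]]; split; first exact: measurable_funM.
by exists (M * N) => w; rewrite normrM ler_pM.
Qed.

Lemma bounded_measurableB f h :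
  bounded_measurable f -> bounded_measurable h ->
  bounded_measurable (fun w => f w - h w).
Proof.
move=> bf bh; have := bounded_measurableD bf
  (bounded_measurableM (bounded_measurable_cst (-1)) bh).
by under [X in bounded_measurable X -> _]eq_fun do rewrite mulN1r.
Qed.

Lemma bounded_measurable_sum (I : Type) (s : seq I) (f : I -> T -> R) :
  (forall i, bounded_measurable (f i)) ->
  bounded_measurable (fun w => \sum_(i <- s) f i w).
Proof.
move=> bf; elim: s => [|i s IH].
  under eq_fun do rewrite big_nil; exact: bounded_measurable_cst.
by under eq_fun do rewrite big_cons; exact: bounded_measurableD.
Qed.

Lemma bounded_measurable_dot (p : nat) (X Y : T -> 'rV[R]_p) :
  (forall j, bounded_measurable (fun w => X w 0 j)) ->
  (forall j, bounded_measurable (fun w => Y w 0 j)) ->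
  bounded_measurable (fun w => dot (X w) (Y w)).
Proof.
by move=> bX bY; apply: bounded_measurable_sum => j; exact: bounded_measurableM.
Qed.

Lemma bounded_measurable_subr (p : nat) (X Y : T -> 'rV[R]_p) :
  (forall j, bounded_measurable (fun w => X w 0 j)) ->
  (forall j, bounded_measurable (fun w => Y w 0 j)) ->
  forall j, bounded_measurable (fun w => (X w - Y w) 0 j).
Proof.
move=> bX bY j; under eq_fun do rewrite !mxE; exact: bounded_measurableB.
Qed.

Variable P : probability T R.

Definition rintegrable f := P.-integrable setT (EFin \o f).

Lemma bounded_measurable_integrable f : bounded_measurable f -> rintegrable f.
Proof.
move=> [mf [M fM]]; apply: measurable_bounded_integrable => //.
  by rewrite (le_lt_trans (probability_le1 P _)) ?ltry.
by exists M; split; [exact: num_real|move=> x Mx w _; exact: le_trans (fM w) (ltW Mx)].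
Qed.

Lemma rintegrableD f h : rintegrable f -> rintegrable h ->
  rintegrable (fun w => f w + h w).
Proof. exact: integrableD. Qed.

Lemma rintegrableZl r f : rintegrable f -> rintegrable (fun w => r * f w).
Proof. exact: integrableZl. Qed.

Lemma rintegrableB f h : rintegrable f -> rintegrable h ->
  rintegrable (fun w => f w - h w).
Proof. exact: integrableB. Qed.

Lemma rintegrable_sum (I : Type) (s : seq I) (f : I -> T -> R) :
  (forall i, rintegrable (f i)) -> rintegrable (fun w => \sum_(i <- s) f i w).
Proof.
move=> bf; elim: s => [|i s IH].
  under eq_fun do rewrite big_nil.
  exact/bounded_measurable_integrable/bounded_measurable_cst.
by under eq_fun do rewrite big_cons; exact: rintegrableD.
Qed.

Lemma rintegrableM f h : bounded_measurable f -> rintegrable h ->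
  rintegrable (fun w => f w * h w).
Proof.
move=> [mf [M fM]] ih; apply: (integrableMr _ mf _ ih) => //.
by exists M; split; [exact: num_real|move=> x Mx w _; exact: le_trans (fM w) (ltW Mx)].
Qed.

Lemma Rintegral_sum (I : Type) (s : seq I) (f : I -> T -> R) :
  (forall i, rintegrable (f i)) ->
  Rintegral P setT (fun w => \sum_(i <- s) f i w) = \sum_(i <- s) Rintegral P setT (f i).
Proof.
move=> bf; elim: s => [|i s IH].
  rewrite big_nil (_ : (fun _ => _) = fun=> 0).
    by rewrite Rintegral_cst// mul0r.
  by apply/funext => w; rewrite big_nil.
rewrite big_cons -IH -(RintegralD measurableT (bf i) (rintegrable_sum s bf)).
by congr Rintegral; apply/funext => w; rewrite big_cons.
Qed.

Lemma Rintegral_prob_cst (r : R) : Rintegral P setT (fun=> r) = r.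
Proof.
by rewrite Rintegral_cst// [X in fine X](@probability_setT _ _ _ P) mulr1.
Qed.

Lemma expectation_Rintegral f : rintegrable f ->
  ('E_P[f] = (Rintegral P setT f)%:E)%E.
Proof. by move=> fi; rewrite unlock fineK//; exact: integrable_fin_num. Qed.

End BoundedMeasurable.

(** * One step in expectation, with [lam = 0] in part 1 and [lam = Delta] in part 2 *)

Section NoisyStep.
Context {d : measure_display} {Omega : measurableType d} {R : realType}.
Variables (P : probability Omega R) (n p N : nat) (sigma : R).
Variables (pick : nat -> Omega -> 'I_n) (b : nat -> 'I_p -> {RV P >-> R}).
Hypothesis sigma0 : 0 <= sigma.
Hypothesis draws : noise_gd_draws N sigma pick b.
Variables (U : Type) (C : set 'rV[R]_p) (l : 'rV[R]_p -> U -> R).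
Variables (g : 'rV[R]_p -> U -> 'rV[R]_p) (D : 'I_n -> U) (eta : nat -> R).
Variables (theta1 : 'rV[R]_p) (L lam : R).
Hypotheses (Ccl : closed C) (Cbd : bounded_set C) (Ccv : convex_set C).
Hypothesis C1 : C theta1.
Hypothesis n0 : (0 < n)%N.
Hypothesis lL : forall u, lipschitz2 C L (l ^~ u).
Hypothesis mg : forall u,
  measurable_fun (C : set (Borel_rV R p)) (g ^~ u : Borel_rV R p -> Borel_rV R p).
Hypothesis gL : forall x u, C x -> norm2 (g x u) <= L.
Hypothesis gsc : forall u x y, C x -> C y ->
  l x u + dot (g x u) (y - x) + lam / 2 * dot (y - x) (y - x) <= l y u.

Let C0 : C !=set0. Proof. by exists theta1. Qed.
Local Notation F := (total_loss l D).
Local Notation E := (Rintegral P setT).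
Local Notation past_space k := (@past_space d Omega R P n p N pick b k).

Definition iterate k w :=
  noise_gd_iter C g D eta theta1 (pick ^~ w) (fun t => \row_j b t j w) k.
Local Notation X := iterate.

Lemma iterate_in k w : C (X k w).
Proof. exact: noise_gd_iter_in. Qed.

Lemma lipschitz_ge0 : 0 <= L.
Proof. exact: le_trans (norm2_ge0 _) (gL (D (Ordinal n0)) C1). Qed.

Lemma bounded_coord x : C x -> exists M : R, forall y j, C y -> `|y 0 j| <= M.
Proof.
move=> Cx; exists (norm2 x + diam2 C) => y j Cy.
apply: le_trans (abs_coord_le_norm2 y j) _.
rewrite -{1}(subrK x y) addrC; apply: le_trans (norm2D _ _) _.
by rewrite lerD2l; exact: norm2_le_diam2.
Qed.

Lemma bounded_measurable_iterate k s j : (s <= k <= N)%N ->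
  bounded_measurable (fun w : past_space k => X s w 0 j).
Proof.
move=> /andP[sk kN]; split.
  apply: (@noise_gd_iter_measurable R p n U C g D eta theta1 Ccl Cbd Ccv C1 _
    (past_space k) pick b) => //.
  - by move=> t i ts; apply: past_measurable_pick; rewrite (leq_trans ts).
  - by move=> t i ts; apply: past_measurable_noise; rewrite (leq_trans ts).
have [M HM] := bounded_coord C1.
by exists M => w; apply: HM; exact: iterate_in.
Qed.

Lemma bounded_measurable_gradient k u j : (k <= N)%N ->
  bounded_measurable (fun w : past_space k => g (X k w) u 0 j).
Proof.
move=> kN; split.
  apply: (measurable_Borel_comp _ Ccl (mg u)); first exact: iterate_in.
  by move=> i; case: (@bounded_measurable_iterate k k i); rewrite ?leqnn.
exists L => w; apply: le_trans (abs_coord_le_norm2 _ j) _.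
by apply: gL; exact: iterate_in.
Qed.

Lemma bounded_measurable_past k f : bounded_measurable (f : past_space k -> R) ->
  bounded_measurable (f : Omega -> R).
Proof. by move=> [mf bf]; split => //; exact: (past_measurable_fun draws mf). Qed.

Lemma total_loss_lipschitz x y : C x -> C y ->
  `|F x - F y| <= n%:R * L * norm2 (x - y).
Proof.
move=> Cx Cy; rewrite -sumrB; apply: le_trans (ler_norm_sum _ _ _) _.
rewrite -[n in n%:R]card_ord -mulrA mulr_natl -sumr_const.
by apply: ler_sum => i _; exact: lL.
Qed.

Lemma bounded_measurable_total_loss (T : measurableType d) (Y : T -> 'rV[R]_p) :
  (forall w, C (Y w)) -> (forall j, bounded_measurable (fun w => Y w 0 j)) ->
  bounded_measurable (fun w => F (Y w)).
Proof.
move=> CY bY; split.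
  (* The loss is controlled on [C] only; composed with the projection it becomes continuous on the
     whole space and keeps its values on [C]. *)
  rewrite (_ : (fun w => _) = fun w => F (Defs.proj C (Y w))); last first.
    by apply/funext => w; rewrite proj_id.
  apply: (measurable_continuous_rV (f := fun x => F (Defs.proj C x))); last first.
    by move=> j; case: (bY j).
  apply: (@lipschitz2_continuous _ _ _ (n%:R * L)) => x y.
  apply: le_trans (total_loss_lipschitz (proj_in Ccl Cbd C0 x) (proj_in Ccl Cbd C0 y)) _.
  rewrite ler_wpM2l ?mulr_ge0 ?lipschitz_ge0//.
  exact: proj_nonexpansive.
exists (`|F theta1| + n%:R * L * diam2 C) => w.
rewrite -(subrK (F theta1) (F (Y w))) addrC.
apply: le_trans (ler_normD _ _) _; rewrite lerD2l.
apply: le_trans (total_loss_lipschitz (CY w) C1) _.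
by rewrite ler_wpM2l ?mulr_ge0 ?lipschitz_ge0//; exact: norm2_le_diam2.
Qed.

Lemma total_loss_regret x y : C x -> C y ->
  F x - F y + n%:R * lam / 2 * dot (x - y) (x - y) <=
  \sum_(i < n) dot (g x (D i)) (x - y).
Proof.
move=> Cx Cy; rewrite -sumrB -[n in n%:R]card_ord -mulrA -mulrA mulr_natl -sumr_const.
rewrite -big_split/=; apply: ler_sum => i _.
have := gsc (D i) Cx Cy; rewrite -(opprB x y) !dotE; lra.
Qed.

Lemma gradient_sqr_le x u : C x -> dot (g x u) (g x u) <= L ^+ 2.
Proof.
move=> Cx; rewrite -sqr_norm2.
by rewrite lerXn2r ?nnegrE ?norm2_ge0 ?lipschitz_ge0//; exact: gL.
Qed.

(* Only T - 1 steps are made, so there is no draw to compare theta_T with; its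
   regret is bounded by AM-GM with the exact subgradients instead. *)
Lemma exact_step_regret e x y : 0 < e -> C x -> C y ->
  F x - F y <= (1 / (2 * e) - n%:R * lam / 2) * dot (x - y) (x - y)
    + e / 2 * (n%:R * L) ^+ 2.
Proof.
move=> e0 Cx Cy; have := total_loss_regret Cx Cy.
have n0' : (0 : R) < n%:R by rewrite ltr0n.
set q := dot (x - y) _.
suff : \sum_(i < n) dot (g x (D i)) (x - y) <=
    1 / (2 * e) * q + e / 2 * (n%:R * L) ^+ 2 by lra.
(* Each of the [n] inner products gets the Young weight [e * n]. *)
have -> : 1 / (2 * e) * q + e / 2 * (n%:R * L) ^+ 2 =
    \sum_(i < n) (q / (2 * (e * n%:R)) + e * n%:R / 2 * L ^+ 2).
  by rewrite sumr_const card_ord -mulr_natl; field; rewrite !gt_eqF.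
apply: ler_sum => i _; rewrite dotC.
apply: le_trans (dot_le_half _ _ (mulr_gt0 e0 n0')) _.
rewrite lerD2l; apply: ler_wpM2l; last exact: gradient_sqr_le.
by rewrite divr_ge0// mulr_ge0// ltW.
Qed.

(** Projecting brings the iterate no farther from [y]. The sampled gradient is written as a sum over
    the entries, so that each summand is a function of the past times an indicator of the pick;
    [dotD_le] removes the cross term of gradient and noise. *)
Lemma step_dist_le k w y : C y ->
  dot (X k.+1 w - y) (X k.+1 w - y) <=
  dot (X k w - y) (X k w - y)
  - 2 * eta k.+1 * n%:R *
      \sum_(i < n) dot (g (X k w) (D i)) (X k w - y) * (pick k w == i)%:R
  - 2 * eta k.+1 * \sum_(j < p) (X k w - y) 0 j * b k j w
  + eta k.+1 ^+ 2 * (2 * (n%:R * L) ^+ 2 + 2 * \sum_(j < p) b k j w ^+ 2).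
Proof.
move=> Cy; rewrite /X/=.
apply: le_trans (proj_dist_le Ccl Cbd Ccv C0 _ Cy) _; rewrite -/(X k w).
set x := X k w; set e := eta k.+1; set G := g x (D (pick k w)).
rewrite (bigD1 (pick k w))//= eqxx mulr1 big1 => [|i ne]; last first.
  by rewrite eq_sym (negPf ne) mulr0.
rewrite addr0 -/G.
set B := \row_j b k j w.
have Bj j : B 0 j = b k j w by rewrite mxE.
have -> : \sum_(j < p) (x - y) 0 j * b k j w = dot (x - y) B.
  by apply: eq_bigr => j _; rewrite Bj.
have -> : \sum_(j < p) b k j w ^+ 2 = dot B B.
  by apply: eq_bigr => j _; rewrite Bj expr2.
have -> : x - e *: (n%:R *: G + B) - y = (x - y) - e *: (n%:R *: G + B).
  by rewrite addrAC.
have H1 : dot (n%:R *: G) (n%:R *: G) <= (n%:R * L) ^+ 2.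
  rewrite dotZl dotZr mulrA -expr2 exprMn ler_wpM2l ?sqr_ge0//.
  exact/gradient_sqr_le/iterate_in.
have H2 := dotD_le (n%:R *: G) B.
have -> : dot (x - y - e *: (n%:R *: G + B)) (x - y - e *: (n%:R *: G + B)) =
   dot (x - y) (x - y) - 2 * e * n%:R * dot G (x - y) - 2 * e * dot (x - y) B
   + e ^+ 2 * dot (n%:R *: G + B) (n%:R *: G + B).
  move: (x - y) => z; rewrite !dotE (dotC z G) (dotC B z); ring.
rewrite lerD2l ler_wpM2l ?sqr_ge0//; lra.
Qed.

Lemma noise_integrable k j : (k < N)%N -> rintegrable P (fun w => b k j w ^+ 2).
Proof.
move=> kN; have [_ _ Pb _] := draws.
exact: gaussian_sqr_integrable sigma0 (fun A => Pb k j A kN).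
Qed.

Lemma noise_second_moment k j : (k < N)%N ->
  E (fun w => b k j w ^+ 2) <= 8 * sigma ^+ 2.
Proof.
move=> kN; have [_ _ Pb _] := draws.
rewrite -lee_fin /Rintegral fineK; last first.
  exact: integrable_fin_num (noise_integrable j kN).
exact: gaussian_second_moment sigma0 (fun A => Pb k j A kN).
Qed.

(** As [W] depends on draws before number [k] only, the linear terms of [step_dist_le] average to
    the exact gradient and to zero. The constant 16 is twice the 8 of the second moment bound. *)
Lemma noise_gd_step k (W : Omega -> 'rV[R]_p) : (k < N)%N -> 0 < eta k.+1 ->
  (forall w, C (W w)) ->
  (forall j, bounded_measurable (fun w : past_space k => W w 0 j)) ->
  E (F \o X k) - E (F \o W) <=
  (1 / (2 * eta k.+1) - n%:R * lam / 2) * E (fun w => dot (X k w - W w) (X k w - W w))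
  - 1 / (2 * eta k.+1) * E (fun w => dot (X k.+1 w - W w) (X k.+1 w - W w))
  + eta k.+1 / 2 * (2 * (n%:R * L) ^+ 2 + 16 * p%:R * sigma ^+ 2).
Proof.
move=> kN e0 CW bW; set e := eta k.+1.
have kN' : (k <= N)%N := ltnW kN.
have bX j : bounded_measurable (fun w : past_space k => X k w 0 j).
  by apply: bounded_measurable_iterate; rewrite leqnn.
have bX1 j : bounded_measurable (fun w : Omega => X k.+1 w 0 j).
  by apply: (@bounded_measurable_past k.+1); apply: bounded_measurable_iterate; rewrite leqnn.
have bW' j : bounded_measurable (fun w : Omega => W w 0 j) := bounded_measurable_past (bW j).
have bX' j : bounded_measurable (fun w : Omega => X k w 0 j) := bounded_measurable_past (bX j).
pose z w := X k w - W w.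
have bz j : bounded_measurable (fun w : past_space k => z w 0 j).
  exact: bounded_measurable_subr.
pose A w := dot (z w) (z w).
pose h i w := dot (g (X k w) (D i)) (z w).
have bh i : bounded_measurable (fun w : past_space k => h i w).
  by apply: bounded_measurable_dot => // j; exact: bounded_measurable_gradient.
have iA : rintegrable P A.
  exact/bounded_measurable_integrable/bounded_measurable_past/bounded_measurable_dot.
have ih i : rintegrable P (h i).
  exact/bounded_measurable_integrable/bounded_measurable_past/bh.
have iFX : rintegrable P (F \o X k).
  apply/bounded_measurable_integrable/bounded_measurable_total_loss => // w.
  exact: iterate_in.
have iFW : rintegrable P (F \o W).
  exact/bounded_measurable_integrable/bounded_measurable_total_loss.
have regret : E (F \o X k) - E (F \o W) + n%:R * lam / 2 * E A <= \sum_(i < n) E (h i).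
  rewrite -Rintegral_sum// -RintegralB// -RintegralZl// -RintegralD//; last 2 first.
  - exact: rintegrableB.
  - exact: rintegrableZl.
  apply: le_Rintegral => //.
  - by apply: rintegrableD; [exact: rintegrableB|exact: rintegrableZl].
  - exact: rintegrable_sum.
  - by move=> w _; apply: total_loss_regret => //; exact: iterate_in.
pose Z := fun w => \sum_(i < n) h i w * (pick k w == i)%:R.
pose B := fun w => \sum_(j < p) z w 0 j * b k j w.
pose Q := fun w => \sum_(j < p) b k j w ^+ 2.
have iZi i : rintegrable P (fun w => h i w * (pick k w == i)%:R).
  apply: rintegrableM; first exact: bounded_measurable_past (bh i).
  apply: bounded_measurable_integrable; split; last first.
    by exists 1 => w; case: eqP; rewrite ?normr1 ?normr0.
  have [mp _ _ _] := draws.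
  rewrite (_ : (fun w => _) = \1_(pick k @^-1` [set i])).
    by apply: measurable_indic; exact: mp.
  apply/funext => w; rewrite indicE; congr (_%:R); congr nat_of_bool.
  by apply/eqP/idP; rewrite inE.
have iZ : rintegrable P Z by exact: rintegrable_sum.
have iBj j : rintegrable P (fun w => z w 0 j * b k j w).
  apply: rintegrableM; first exact: bounded_measurable_past (bz j).
  have [_ _ Pb _] := draws.
  exact: gaussian_integrable sigma0 (fun A => Pb k j A kN).
have iB : rintegrable P B by exact: rintegrable_sum.
have iQ : rintegrable P Q by apply: rintegrable_sum => j; exact: noise_integrable.
(* The factor [n] of the update cancels the sampling probability [1 / n]. *)
have EZ : n%:R * E Z = \sum_(i < n) E (h i).
  rewrite Rintegral_sum//.
  rewrite mulr_sumr; apply: eq_bigr => i _.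
  have [mh Mh] := bh i.
  rewrite (Rintegral_past_pick draws)// mulrA divff ?mul1r//.
  by rewrite pnatr_eq0 -lt0n.
have EB : E B = 0.
  rewrite Rintegral_sum// big1// => j _; have [mz Mz] := bz j.
  exact: (Rintegral_past_noise sigma0 draws).
have EQ : E Q <= 8 * p%:R * sigma ^+ 2.
  rewrite Rintegral_sum; last by move=> j; exact: noise_integrable.
  rewrite -mulrA mulrCA mulr_natl -[p in X in _ <= X]card_ord -sumr_const.
  by apply: ler_sum => j _; exact: noise_second_moment.
pose rhs w := A w + - (2 * e * n%:R) * Z w + - (2 * e) * B w +
  (e ^+ 2 * 2 * (n%:R * L) ^+ 2 + e ^+ 2 * 2 * Q w).
have icst r : rintegrable P (fun=> r).
  exact/bounded_measurable_integrable/bounded_measurable_cst.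
have i1 := rintegrableZl (- (2 * e * n%:R)) iZ.
have i2 := rintegrableZl (- (2 * e)) iB.
have i3 := rintegrableZl (e ^+ 2 * 2) iQ.
have i4 := icst (e ^+ 2 * 2 * (n%:R * L) ^+ 2).
have Erhs : E rhs = E A - 2 * e * n%:R * E Z - 2 * e * E B +
    (e ^+ 2 * 2 * (n%:R * L) ^+ 2 + e ^+ 2 * 2 * E Q).
  rewrite /rhs (RintegralD measurableT (rintegrableD (rintegrableD iA i1) i2)
    (rintegrableD i4 i3)).
  rewrite (RintegralD measurableT (rintegrableD iA i1) i2).
  rewrite (RintegralD measurableT iA i1) (RintegralD measurableT i4 i3).
  rewrite (RintegralZl _ measurableT iZ) (RintegralZl _ measurableT iB).
  rewrite (RintegralZl _ measurableT iQ) Rintegral_prob_cst.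
  by rewrite !mulNr.
have step : E (fun w => dot (X k.+1 w - W w) (X k.+1 w - W w)) <= E rhs.
  apply: le_Rintegral => //.
  - apply/bounded_measurable_integrable/bounded_measurable_dot;
      exact: bounded_measurable_subr.
  - exact: rintegrableD (rintegrableD (rintegrableD iA i1) i2) (rintegrableD i4 i3).
  - move=> w _; apply: le_trans (step_dist_le k w (CW w)) _.
    by rewrite -/e -/(z w) -/(A w) -/(Q w) /rhs -/(Z w) -/(B w); lra.
move: step; rewrite Erhs EB; set d1 := E (fun w => dot _ _).
have -> : 2 * e * n%:R * E Z = 2 * e * \sum_(i < n) E (h i) by rewrite -EZ mulrA.
move: regret EQ; rewrite -/A.
set S := \sum_(i < n) E (h i); set dX := _ - _; set dA := E A.
set q := E Q; set NL := (n%:R * L) ^+ 2 => regret EQ step.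
have e2 : 0 < 2 * e by rewrite mulr_gt0.
have H : 2 * e * dX <= dA - n%:R * lam * e * dA - d1 + e ^+ 2 * (2 * NL + 2 * q).
  have : 2 * e * (dX + n%:R * lam / 2 * dA) <= 2 * e * S by rewrite ler_wpM2l// ltW.
  lra.
have H2 : e ^+ 2 * (2 * NL + 2 * q) <= e ^+ 2 * (2 * NL + 16 * p%:R * sigma ^+ 2).
  by rewrite ler_wpM2l ?sqr_ge0//; lra.
rewrite -(ler_pM2l e2).
apply: le_trans (le_trans H (lerD (lexx _) H2)) _.
rewrite le_eqVlt; apply/orP; left; apply/eqP; field.
by rewrite gt_eqF.
Qed.

(** Here [eta N.+1] is a Young weight rather than a step length. The error term is enlarged to that
    of [noise_gd_step], to make all summands uniform. *)
Lemma exact_last_step (W : Omega -> 'rV[R]_p) : 0 < eta N.+1 ->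
  (forall w, C (W w)) ->
  (forall j, bounded_measurable (fun w => W w 0 j)) ->
  E (F \o X N) - E (F \o W) <=
  (1 / (2 * eta N.+1) - n%:R * lam / 2) * E (fun w => dot (X N w - W w) (X N w - W w))
  + eta N.+1 / 2 * (2 * (n%:R * L) ^+ 2 + 16 * p%:R * sigma ^+ 2).
Proof.
move=> e0 CW bW; set e := eta N.+1.
have bX j : bounded_measurable (fun w : Omega => X N w 0 j).
  by apply: (@bounded_measurable_past N); apply: bounded_measurable_iterate; rewrite leqnn.
have iA : rintegrable P (fun w => dot (X N w - W w) (X N w - W w)).
  by apply/bounded_measurable_integrable/bounded_measurable_dot;
    exact: bounded_measurable_subr.
have iFX : rintegrable P (F \o X N).
  apply/bounded_measurable_integrable/bounded_measurable_total_loss => // w.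
  exact: iterate_in.
have iFW : rintegrable P (F \o W).
  exact/bounded_measurable_integrable/bounded_measurable_total_loss.
have icst r : rintegrable P (fun=> r).
  exact/bounded_measurable_integrable/bounded_measurable_cst.
set al := 1 / (2 * e) - n%:R * lam / 2.
have : E (fun w => (F \o X N) w - (F \o W) w) <=
    E (fun w => al * dot (X N w - W w) (X N w - W w) + e / 2 * (n%:R * L) ^+ 2).
  apply: le_Rintegral => //.
  - exact: rintegrableB.
  - by apply: rintegrableD => //; exact: rintegrableZl.
  - by move=> w _; apply: exact_step_regret => //; exact: iterate_in.
rewrite (RintegralB measurableT iFX iFW).
rewrite (RintegralD measurableT (rintegrableZl al iA) (icst (e / 2 * (n%:R * L) ^+ 2))).
rewrite (RintegralZl _ measurableT iA) Rintegral_prob_cst => /le_trans; apply.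
rewrite lerD2l; apply: ler_wpM2l; first by rewrite divr_ge0// ltW.
have := sqr_ge0 (n%:R * L); have : 0 <= 16 * p%:R * sigma ^+ 2.
  by rewrite mulr_ge0 ?sqr_ge0// mulr_ge0.
lra.
Qed.

(** * From error terms bounded by [Q / t] to the rate of the last iterate *)

Section Rate.
Variables (e : nat -> R) (Q : R) (thetastar : 'rV[R]_p).
Let B := diam2 C ^+ 2.
Let M2 := 2 * (n%:R * L) ^+ 2 + 16 * p%:R * sigma ^+ 2.
Let be t := 1 / (2 * eta t).
Let al t := be t - n%:R * lam / 2.
Hypothesis Cstar : C thetastar.
Hypothesis eta0 : forall t, (1 <= t <= N.+1)%N -> 0 < eta t.
Hypothesis e0 : forall t, (1 <= t <= N.+1)%N -> 0 <= e t.
Hypothesis al1 : 1 / (2 * eta 1) - n%:R * lam / 2 <= e 1%N.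
Hypothesis alS : forall t, (1 < t <= N.+1)%N ->
  1 / (2 * eta t) - n%:R * lam / 2 - 1 / (2 * eta t.-1) <= e t.

Lemma dot_sub_le_diam2 x y : C x -> C y -> dot (x - y) (x - y) <= B.
Proof.
move=> Cx Cy; rewrite -sqr_norm2 lerXn2r ?nnegrE ?norm2_ge0 ?diam2_ge0//.
exact: norm2_le_diam2.
Qed.

(** Iterate number [t] is [X t.-1]. The last hypothesis controls the first distance, which nothing
    precedes in the telescoping: it is zero for [W = X s.-1], and at most [B] for a fixed point with
    [s = 1]. *)
Lemma regret_against (W : Omega -> 'rV[R]_p) s : (1 <= s <= N.+1)%N ->
  (forall w, C (W w)) ->
  (forall k, (s <= k.+1 <= N.+1)%N ->
    forall j, bounded_measurable (fun w : past_space k => W w 0 j)) ->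
  al s * E (fun w => dot (X s.-1 w - W w) (X s.-1 w - W w)) <= e s * B ->
  \sum_(s <= t < N.+2) (E (F \o X t.-1) - E (F \o W)) <=
  \sum_(s <= t < N.+2) (e t * B + eta t / 2 * M2).
Proof.
move=> /andP[s1 sN] CW bW als.
have bW' j : bounded_measurable (fun w => W w 0 j).
  by apply: (@bounded_measurable_past N); apply: bW; rewrite sN leqnn.
apply: (@telescoped_regret R al be
  (fun t => E (fun w => dot (X t.-1 w - W w) (X t.-1 w - W w)))
  e (fun t => eta t / 2 * M2) (fun t => E (F \o X t.-1)) (E (F \o W)) B s N.+1) => //.
- move=> [|k] /andP[sk kN]; first by have := leq_trans s1 sk.
  apply: noise_gd_step => //; first by apply: eta0; exact: ltnW.
  by apply: bW; rewrite sk; exact: ltnW.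
- by apply: exact_last_step => //; apply: eta0; rewrite leqnn.
- by move=> t /andP[st tN]; apply: alS; rewrite (leq_ltn_trans s1 st).
- by move=> t /andP[st tN]; apply: e0; rewrite (leq_trans s1 st).
- move=> t /andP[st tN]; apply/andP; split.
    by apply: Rintegral_ge0 => w _; exact: dot_ge0.
  rewrite -[leRHS](Rintegral_prob_cst P); apply: le_Rintegral => //.
  + have bX j : bounded_measurable (fun w => X t.-1 w 0 j).
      apply: (@bounded_measurable_past t.-1).
      apply: bounded_measurable_iterate; rewrite leqnn/=.
      by rewrite -ltnS prednK// (leq_trans s1 st).
    by apply/bounded_measurable_integrable/bounded_measurable_dot;
      exact: bounded_measurable_subr.
  + exact/bounded_measurable_integrable/bounded_measurable_cst.
  + by move=> w _; apply: dot_sub_le_diam2 => //; exact: iterate_in.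
Qed.

Lemma excess_rate : 0 <= Q ->
  (forall t, (1 <= t <= N.+1)%N -> e t * B + eta t / 2 * M2 <= Q / t%:R) ->
  E (F \o X N) - F thetastar <= Q / N.+1%:R * (3 + 2 * ln N.+1%:R).
Proof.
move=> Q0 vQ.
apply: (@last_iterate_rate R (fun t => E (F \o X t.-1))
  (fun t => e t * B + eta t / 2 * M2) N.+1 (F thetastar) Q) => //.
- move=> [//|s] sN; apply: regret_against => //.
  + by move=> w; exact: iterate_in.
  + by move=> k /andP[sk kN] j; apply: bounded_measurable_iterate; apply/andP; split.
  + rewrite (_ : (fun w => _) = fun=> 0); last first.
      by apply/funext => w; rewrite /= subrr dot0l.
    by rewrite Rintegral_prob_cst mulr0 mulr_ge0 ?sqr_ge0 ?e0.
- have <- : E (F \o (fun=> thetastar)) = F thetastar by rewrite Rintegral_prob_cst.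
  apply: regret_against => //.
  + by move=> k _ j; exact: bounded_measurable_cst.
  + rewrite (_ : X 0 = fun=> theta1)// Rintegral_prob_cst.
    have := dot_sub_le_diam2 C1 Cstar; have := dot_ge0 (theta1 - thetastar).
    have := e0 (isT : (1 <= 1 <= N.+1)%N); move: al1; rewrite -/(be 1) -/(al 1).
    move: (dot _ _) => q; nra.
Qed.

Lemma expected_excess_rate : 0 <= Q ->
  (forall t, (1 <= t <= N.+1)%N -> e t * B + eta t / 2 * M2 <= Q / t%:R) ->
  ('E_P[fun w => (F (X N w) - F thetastar)%R] <=
   (Q / N.+1%:R * (3 + 2 * ln N.+1%:R))%:E)%E.
Proof.
move=> Q0 vQ.
have iFX : rintegrable P (F \o X N).
  apply/bounded_measurable_integrable/bounded_measurable_total_loss => [w|j].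
    exact: iterate_in.
  by apply: (@bounded_measurable_past N); apply: bounded_measurable_iterate; rewrite leqnn.
have icst : rintegrable P (fun=> F thetastar).
  exact/bounded_measurable_integrable/bounded_measurable_cst.
rewrite expectation_Rintegral; last exact: rintegrableB.
rewrite lee_fin (RintegralB measurableT iFX icst) Rintegral_prob_cst.
exact: excess_rate.
Qed.

End Rate.

End NoisyStep.

(** * Rates *)

Section Constants.
Variable R : realType.
Implicit Types (K eps delta L sigma : R) (n p : nat).

Lemma ln_inv_gt0 delta0 : 0 < delta0 < 1 -> 0 < ln (1 / delta0).
Proof. by move=> /andP[d0 d1]; rewrite ln_gt0// div1r invf_gt1. Qed.

Lemma ln_inv_le delta0 delta : 0 < delta <= delta0 -> ln (1 / delta0) <= ln (1 / delta).
Proof.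
move=> /andP[d0 dd]; have d00 := lt_le_trans d0 dd.
by rewrite ler_ln ?posrE ?divr_gt0// !div1r lef_pV2.
Qed.

Lemma ln_natdivE n delta : (0 < n)%N -> 0 < delta ->
  ln (n%:R / delta) = ln n%:R + ln (1 / delta).
Proof.
move=> n0 d0; have n0' : (0 : R) < n%:R by rewrite ltr0n.
by rewrite ln_div ?posrE// div1r lnV ?posrE.
Qed.

(** The first summand is the cost of absorbing [n^2 L^2] into the noise level, the second comes from
    the bound on [sigma ^+ 2]. *)
Definition noise_const K eps0 delta0 := eps0 ^+ 2 / ln (1 / delta0) ^+ 2 + K.

(** Since [ln (n / delta) >= ln (1 / delta0)], the number 3 costs [3 / ln (1 / delta0)] logarithms;
    4 comes from [2 * ln (n ^ 2) = 4 * ln n]. *)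
Definition log_const delta0 := 3 / ln (1 / delta0) + 4.

(** The quantity [m = ln (n / delta) * ln (1 / delta) / eps^2] is at least
    [ln (1 / delta0)^2 / eps0^2], so 1 is at most a constant times [p m], and [n^2 L^2] is
    dominated. *)
Lemma noise_level_le K eps0 delta0 eps delta L sigma n p :
  0 < K -> 0 < delta0 < 1 -> (0 < n)%N -> (0 < p)%N ->
  0 < eps <= eps0 -> 0 < delta <= delta0 ->
  sigma ^+ 2 <= K * (L ^+ 2 * n%:R ^+ 2 * ln (n%:R / delta) * ln (1 / delta)
                     / eps ^+ 2) ->
  n%:R ^+ 2 * L ^+ 2 + p%:R * sigma ^+ 2 <=
  n%:R ^+ 2 * L ^+ 2 * (p%:R * (ln (n%:R / delta) * ln (1 / delta)) / eps ^+ 2)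
  * noise_const K eps0 delta0.
Proof.
move=> K0 hd0 n0 p0 /andP[e0 ee] hd hs.
have c0 := ln_inv_gt0 hd0; have cl := ln_inv_le hd.
have d0 : 0 < delta by case/andP: hd.
have n1 : 0 <= ln n%:R :> R by rewrite ln_ge0// ler1n.
rewrite /noise_const (ln_natdivE n0 d0) in hs *.
move: c0 cl n1 hs; set c := ln (1 / delta0); set l1 := ln (1 / delta).
set lnn := ln n%:R => c0 cl n1 hs.
have p1 : 1 <= p%:R :> R by rewrite ler1n.
set m := (lnn + l1) * l1 / eps ^+ 2.
have e20 : 0 < eps ^+ 2 by rewrite exprn_gt0.
have e200 : 0 < eps0 ^+ 2 by rewrite exprn_gt0// (lt_le_trans e0).
have c20 : 0 < c ^+ 2 by rewrite exprn_gt0.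
have cm : c ^+ 2 / eps0 ^+ 2 <= m.
  rewrite /m; apply: ler_pM.
  - exact: ltW.
  - by rewrite invr_ge0 ltW.
  - by rewrite expr2; apply: ler_pM; [exact: ltW|exact: ltW|lra|exact: cl].
  - rewrite lef_pV2 ?posrE// lerXn2r ?nnegrE//; first exact: ltW.
    exact: le_trans (ltW e0) ee.
have m0 : 0 <= m by apply: le_trans cm; rewrite divr_ge0 ?ltW.
have one : 1 <= p%:R * m * (eps0 ^+ 2 / c ^+ 2).
  have e1 : 1 = 1 * (c ^+ 2 / eps0 ^+ 2) * (eps0 ^+ 2 / c ^+ 2) :> R.
    by field; rewrite !gt_eqF// (lt_le_trans e0).
  rewrite [leLHS]e1.
  apply: ler_wpM2r; first by rewrite divr_ge0 ?ltW.
  by apply: ler_pM; [exact: ler01|by rewrite divr_ge0 ?ltW|exact: p1|exact: cm].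
have -> : p%:R * ((lnn + l1) * l1) / eps ^+ 2 = p%:R * m by rewrite /m; ring.
have nL0 : 0 <= n%:R ^+ 2 * L ^+ 2 by rewrite mulr_ge0 ?sqr_ge0.
have H1 : n%:R ^+ 2 * L ^+ 2 <=
    n%:R ^+ 2 * L ^+ 2 * (p%:R * m * (eps0 ^+ 2 / c ^+ 2)).
  by rewrite ler_peMr.
have H2 : p%:R * sigma ^+ 2 <= p%:R * (K * (n%:R ^+ 2 * L ^+ 2 * m)).
  rewrite ler_wpM2l//; apply: le_trans hs _; rewrite le_eqVlt; apply/orP; left.
  by apply/eqP; rewrite /m; ring.
apply: le_trans (lerD H1 H2) _; rewrite le_eqVlt; apply/orP; left; apply/eqP; ring.
Qed.

Lemma log_factor_le delta0 delta n :
  0 < delta0 < 1 -> (0 < n)%N -> 0 < delta <= delta0 ->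
  3 + 2 * ln (n%:R ^+ 2) <= log_const delta0 * ln (n%:R / delta).
Proof.
move=> hd0 n0 hd.
have c0 := ln_inv_gt0 hd0; have cl := ln_inv_le hd.
have d0 : 0 < delta by case/andP: hd.
have n1 : 0 <= ln n%:R :> R by rewrite ln_ge0// ler1n.
rewrite lnXn ?ltr0n// ln_natdivE// /log_const.
move: c0 cl n1; set c := ln (1 / delta0); set l1 := ln (1 / delta).
move: (ln n%:R) => m c0 cl m0.
have : 3 <= 3 / c * (m + l1).
  by rewrite -mulrA ler_peMr// mulrC ler_pdivlMr//; lra.
rewrite mulr2n; lra.
Qed.

End Constants.

Section Degenerate.
Variables (R : realType) (p n : nat) (C : set 'rV[R]_p) (U : Type).
Variables (l : 'rV[R]_p -> U -> R) (D : 'I_n -> U) (L : R).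
Hypotheses (Cbd : bounded_set C) (lL : forall u, lipschitz2 C L (l ^~ u)).
Hypothesis L0 : 0 <= L.

Lemma total_loss_constant x y : (p == 0%N) || (L * diam2 C == 0) ->
  C x -> C y -> total_loss l D x = total_loss l D y.
Proof.
move=> deg Cx Cy; apply: eq_bigr => i _; apply/eqP; rewrite -subr_eq0 -normr_le0.
apply: le_trans (lL (D i) Cx Cy) _; case/orP: deg => [/eqP p0|/eqP <-].
  rewrite (_ : norm2 _ = 0) ?mulr0//.
  apply/eqP; rewrite sqrtr_eq0 /dot big1// => j.
  by case: (j) => k kp; exfalso; rewrite p0 in kp.
by rewrite ler_wpM2l// norm2_le_diam2.
Qed.

End Degenerate.

Lemma expectation_excess_constant d (T : measurableType d) (R : realType)
    (P : probability T R) (f : T -> R) (r B : R) :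
  (forall w, f w = r) -> 0 <= B -> ('E_P[fun w => (f w - r)%R] <= B%:E)%E.
Proof.
move=> fr B0; rewrite (_ : (fun w => _) = cst 0).
  by rewrite expectation_cst lee_fin.
by apply/funext => w; rewrite fr subrr.
Qed.

Theorem theorem2p4 (R : realType) (K eps0 delta0 : R)
    (hK : 0 < K) (heps0 : 0 < eps0) (hdelta0 : 0 < delta0 < 1) :
  exists2 c : R, 0 < c &
  forall (p n : nat) (C : set 'rV[R]_p) (L : R)
    (U : Type) (l : 'rV[R]_p -> U -> R) (g : 'rV[R]_p -> U -> 'rV[R]_p)
    (D : 'I_n -> U) (theta1 thetastar : 'rV[R]_p) (eps delta sigma : R)
    (disp : measure_display) (Omega : measurableType disp)
    (P : probability Omega R) (pick : nat -> Omega -> 'I_n)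
    (b : nat -> 'I_p -> {RV P >-> R}),
  (0 < n)%N ->
  closed C -> bounded_set C -> convex_set C ->
  (forall d : U, convex_function C (l ^~ d)) ->
  (forall d : U, lipschitz2 C L (l ^~ d)) ->
  subgradient_oracle C L l g ->
  C theta1 ->
  is_argmin C (total_loss l D) thetastar ->
  0 < eps <= eps0 -> 0 < delta <= delta0 ->
  0 <= sigma ->
  sigma ^+ 2 <= K * (L ^+ 2 * n%:R ^+ 2 * ln (n%:R / delta) * ln (1 / delta)
                     / eps ^+ 2) ->
  noise_gd_draws (n ^ 2).-1 sigma pick b ->
  (let eta t := diam2 C /
       Num.sqrt (t%:R * (n%:R ^+ 2 * L ^+ 2 + p%:R * sigma ^+ 2)) in
   ('E_P[fun w => (total_loss l D (theta_priv C g D eta theta1 pick b w)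
                  - total_loss l D thetastar)%R]
    <= (c * (L * diam2 C * (ln (n%:R / delta) `^ (3 / 2))
             * Num.sqrt (p%:R * ln (1 / delta)) / eps))%:E)%E)
  /\
  (forall Delta : R, 0 < Delta ->
   (forall d : U, strongly_convex C Delta (l ^~ d)) ->
   let eta t := 1 / (Delta * n%:R * t%:R) in
   ('E_P[fun w => (total_loss l D (theta_priv C g D eta theta1 pick b w)
                  - total_loss l D thetastar)%R]
    <= (c * (L ^+ 2 * ln (n%:R / delta) ^+ 2 * p%:R * ln (1 / delta)
             / (n%:R * Delta * eps ^+ 2)))%:E)%E).
Proof.
pose K1 := noise_const K eps0 delta0; pose K2 := log_const delta0.
have c0 := ln_inv_gt0 hdelta0.
have K10 : 0 < K1 by rewrite /K1 /noise_const ltr_wpDl// divr_ge0 ?sqr_ge0.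
have K20 : 0 < K2 by rewrite /K2 /log_const ltr_wpDl// divr_ge0// ltW.
(* The sum of the constants of the two parts, so that one [c] serves both. *)
exists (9 * K2 * Num.sqrt K1 + 8 * K1 * K2).
  by rewrite ltr_pwDr ?mulr_gt0// !mulr_ge0 ?sqrtr_ge0// ltW.
move=> p n C L U l g D theta1 thetastar eps delta sigma disp Omega P pick b.
move=> n0 Ccl Cbd Ccv _ lL orc C1 [Cs _] heps hdelta sigma0 hsigma draws.
have gL x u : C x -> norm2 (g x u) <= L by case: (orc u) => _ _; apply.
have gs x u : C x -> subgradient C (l ^~ u) x (g x u) by case: (orc u) => _ + _; apply.
have mg u := let: And3 h _ _ := orc u in h.
have C0 : C !=set0 by exists theta1.
have L0 : 0 <= L := lipschitz_ge0 D C1 n0 gL.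
have d0 := diam2_ge0 Cbd C0.
have n0' : (0 : R) < n%:R by rewrite ltr0n.
have N1 : (n ^ 2).-1.+1 = (n ^ 2)%N by rewrite prednK// expn_gt0 n0.
have NR : (n ^ 2).-1.+1%:R = n%:R ^+ 2 :> R by rewrite N1 natrX.
have [e0 ee] := andP heps.
have cl := ln_inv_le hdelta.
have [del0 _] := andP hdelta.
have Lam : ln (1 / delta) <= ln (n%:R / delta).
  by rewrite ln_natdivE// lerDr ln_ge0// ler1n.
have logle := log_factor_le hdelta0 n0 hdelta.
pose lam1 := ln (1 / delta); pose lam := ln (n%:R / delta).
have lam10 : 0 < lam1 by exact: lt_le_trans cl.
have lam0 : 0 < lam by exact: lt_le_trans Lam.
rewrite -/lam in logle; rewrite -/lam -/lam1.
set c := 9 * K2 * Num.sqrt K1 + 8 * K1 * K2.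
have c1 : 9 * K2 * Num.sqrt K1 <= c by rewrite /c lerDl !mulr_ge0// ltW.
have c2 : 8 * K1 * K2 <= c by rewrite /c lerDr !mulr_ge0 ?sqrtr_ge0// ltW.
have cpos : 0 <= c by apply: le_trans c2; rewrite !mulr_ge0// ltW.
have rhs1 : 0 <= L * diam2 C * lam `^ (3 / 2) * Num.sqrt (p%:R * lam1) / eps.
  by rewrite divr_ge0 ?(ltW e0)// !mulr_ge0 ?powR_ge0 ?sqrtr_ge0.
have rhs2 Delta : 0 < Delta ->
    0 <= L ^+ 2 * lam ^+ 2 * p%:R * lam1 / (n%:R * Delta * eps ^+ 2).
  move=> Delta0; apply: divr_ge0; apply: mulr_ge0; rewrite ?sqr_ge0 ?(ltW lam10)//.
    by apply: mulr_ge0 => //; apply: mulr_ge0; exact: sqr_ge0.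
  by apply: mulr_ge0 => //; exact: ltW.
(* In these cases the claimed bound may vanish and the step size of part 1 may be zero, but the loss
   is constant on [C]. *)
have [deg|] := boolP ((p == 0%N) || (L * diam2 C == 0)).
  have Fc x : C x -> total_loss l D x = total_loss l D thetastar.
    by move=> Cx; apply: (total_loss_constant D Cbd lL L0 deg).
  have Fpriv eta w : total_loss l D (theta_priv C g D eta theta1 pick b w) =
      total_loss l D thetastar.
    by apply: Fc; exact: noise_gd_iter_in.
  split; first by apply: expectation_excess_constant => //; exact: mulr_ge0.
  move=> Delta Delta0 _; apply: expectation_excess_constant => //.
  exact: mulr_ge0 cpos (rhs2 Delta Delta0).
rewrite negb_or -lt0n mulf_eq0 negb_or => /and3P[p0 Ln0 dn0].
have Lpos : 0 < L by rewrite lt0r Ln0.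
have dpos : 0 < diam2 C by rewrite lt0r dn0.
have Gle := noise_level_le hK hdelta0 n0 p0 heps hdelta hsigma.
set G2 := n%:R ^+ 2 * L ^+ 2 + p%:R * sigma ^+ 2 in Gle *.
rewrite -/lam -/lam1 -/K1 in Gle.
have G20 : 0 < G2 by rewrite ltr_pwDl ?mulr_gt0 ?exprn_gt0// mulr_ge0 ?sqr_ge0.
have M2le : 2 * (n%:R * L) ^+ 2 + 16 * p%:R * sigma ^+ 2 <= 16 * G2.
  by rewrite /G2 exprMn; have := sqr_ge0 (n%:R * L); rewrite exprMn; lra.
split.
  lazy zeta.
  pose eta (t : nat) := diam2 C / Num.sqrt (t%:R * G2).
  pose G := Num.sqrt G2; have G0 : 0 < G by rewrite sqrtr_gt0.
  have GG : G ^+ 2 = G2 by rewrite sqr_sqrtr// ltW.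
  have sqrt0 (t : nat) : (0 < t)%N -> 0 < Num.sqrt t%:R :> R.
    by move=> t0; rewrite sqrtr_gt0 ltr0n.
  have sqrtt (t : nat) : Num.sqrt t%:R ^+ 2 = t%:R :> R by rewrite sqr_sqrtr.
  have etaE t : eta t = diam2 C / (Num.sqrt t%:R * G) by rewrite /eta sqrtrM.
  have ietaE t : (0 < t)%N -> 1 / (2 * eta t) = G / (2 * diam2 C) * Num.sqrt t%:R.
    move=> t0; rewrite etaE; have := sqrt0 t t0.
    by move=> st0; field; rewrite !gt_eqF.
  pose e t := G / (2 * diam2 C) * (Num.sqrt t%:R - Num.sqrt t.-1%:R).
  have Gd : 0 <= G / (2 * diam2 C) by rewrite divr_ge0 ?mulr_ge0 ?(ltW G0).
  (* As [sqrt t - sqrt (t - 1) <= 1 / sqrt t], the distance term is at most [diam G / (2 sqrt t)];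
     the other is at most [8 diam G / sqrt t]. Hence 9, and [sqrt t <= n] turns the sum into
     [Q / t]. *)
  pose Q := 9 * diam2 C * G * n%:R.
  have Q0 : 0 <= Q by rewrite !mulr_ge0 ?(ltW G0).
  apply: (@le_trans _ _ (Q / n%:R ^+ 2 * (3 + 2 * ln (n%:R ^+ 2)))%:E).
    rewrite -NR; apply: (@expected_excess_rate _ _ _ _ _ _ _ sigma _ _ sigma0 draws
      U C l g D eta theta1 L 0 Ccl Cbd Ccv C1 n0 lL mg gL _ e Q) => //.
    - by move=> u x y Cx Cy; rewrite !mul0r addr0; exact: gs.
    - by move=> t /andP[t0 _]; rewrite etaE divr_gt0// mulr_gt0// sqrt0.
    - move=> t _; rewrite mulr_ge0// subr_ge0 ler_sqrt ?ler_nat ?leq_pred//.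
    - by rewrite ietaE// /e sqrtr0 subr0 mulr0 mul0r subr0.
    - move=> [//|[//|t]] _; rewrite !ietaE//= /e/=; lra.
    - move=> t /andP[t0 tN]; have st := sqrt0 t t0.
      have eta0 : 0 <= eta t / 2.
        by rewrite etaE !divr_ge0// mulr_ge0 ?sqrtr_ge0.
      apply: le_trans (lerD (lexx _) (ler_wpM2l eta0 M2le)) _.
      have sn : Num.sqrt t%:R <= n%:R :> R.
        rewrite -[leRHS]ger0_norm// -sqrtr_sqr ler_sqrt ?sqr_ge0//.
        by rewrite -natrX ler_nat -N1.
      have s1 : (Num.sqrt t%:R - Num.sqrt t.-1%:R) * Num.sqrt t%:R <= 1 :> R.
        rewrite mulrBl -expr2 sqrtt.
        have tE : t%:R = t.-1%:R + 1 :> R by rewrite natr1 prednK.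
        have : Num.sqrt t.-1%:R ^+ 2 <= Num.sqrt t.-1%:R * Num.sqrt t%:R :> R.
          by rewrite expr2 ler_wpM2l ?sqrtr_ge0// ler_sqrt// ler_nat leq_pred.
        rewrite sqrtt; lra.
      have dG : 0 < diam2 C * G by rewrite mulr_gt0.
      rewrite -[X in Q / X]sqrtt -GG etaE /e /Q.
      move: s1 sn st; set r := Num.sqrt t%:R; set r' := Num.sqrt _ => s1 sn st.
      rewrite -subr_ge0.
      have -> : 9 * diam2 C * G * n%:R / r ^+ 2 -
        (G / (2 * diam2 C) * (r - r') * diam2 C ^+ 2 +
         diam2 C / (r * G) / 2 * (16 * G ^+ 2)) =
        diam2 C * G * (9 * (n%:R - r) + r * (1 - (r - r') * r) / 2 + r / 2) / r ^+ 2.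
        by field; rewrite !gt_eqF.
      rewrite divr_ge0 ?sqr_ge0// mulr_ge0 ?(ltW dG)//.
      have : 0 <= r * (1 - (r - r') * r) by rewrite mulr_ge0 ?(ltW st)// subr_ge0.
      lra.
  rewrite lee_fin.
  apply: le_trans (ler_wpM2l _ logle) _; first by rewrite divr_ge0 ?sqr_ge0.
  (* One logarithm comes from the harmonic sum, the half from the square root of the noise variance
     in [G]. *)
  have powE : lam `^ (3 / 2) = lam * Num.sqrt lam.
    rewrite (_ : 3 / 2 = 1 + 2^-1); last by field.
    rewrite powRD ?gt_eqF ?implybT// powRr1 ?powR12_sqrt//; exact: ltW.
  pose Y := n%:R * L * Num.sqrt lam * Num.sqrt (p%:R * lam1) * Num.sqrt K1 / eps.
  have Y0 : 0 <= Y by rewrite divr_ge0 ?(ltW e0)// !mulr_ge0 ?sqrtr_ge0.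
  have GY : G <= Y.
    rewrite -(ger0_norm Y0) -sqrtr_sqr ler_sqrt ?sqr_ge0//; apply: le_trans Gle _.
    rewrite /Y !exprMn exprVn !sqr_sqrtr ?mulr_ge0 ?(ltW lam0) ?(ltW lam10) ?(ltW K10)//.
    by rewrite le_eqVlt; apply/orP; left; apply/eqP; ring.
  apply: le_trans (ler_wpM2r rhs1 c1); rewrite powE.
  have -> : 9 * K2 * Num.sqrt K1 * (L * diam2 C * (lam * Num.sqrt lam) *
      Num.sqrt (p%:R * lam1) / eps) = 9 * diam2 C * Y * n%:R / n%:R ^+ 2 * (K2 * lam).
    by rewrite /Y; field; rewrite !gt_eqF.
  apply: ler_wpM2r; first by rewrite mulr_ge0 ?(ltW K20) ?(ltW lam0).
  apply: ler_wpM2r; first by rewrite invr_ge0 sqr_ge0.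
  by apply: ler_wpM2r => //; rewrite ler_wpM2l// mulr_ge0.
move=> Delta Delta0 sc; lazy zeta; pose eta t : R := 1 / (Delta * n%:R * t%:R).
have etaE t : (0 < t)%N -> 1 / (2 * eta t) = Delta * n%:R * t%:R / 2.
  by move=> t0; rewrite /eta; field; rewrite !gt_eqF ?ltr0n.
(* Per step, [1 / (2 * eta t)] grows by [Delta * n / 2], exactly what strong convexity gives back.
   So [e = 0], and what remains is [eta t / 2 * (16 * G2) = Q / t]. *)
pose Q := 8 * G2 / (Delta * n%:R).
have Q0 : 0 <= Q by rewrite divr_ge0 ?mulr_ge0 ?ltW.
apply: (@le_trans _ _ (Q / n%:R ^+ 2 * (3 + 2 * ln (n%:R ^+ 2)))%:E).
  rewrite -NR; apply: (@expected_excess_rate _ _ _ _ _ _ _ sigma _ _ sigma0 draws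
    U C l g D eta theta1 L Delta Ccl Cbd Ccv C1 n0 lL mg gL _ (fun=> 0) Q) => //.
  - move=> u x y Cx Cy; rewrite -sqr_norm2; apply: sc => //; exact: gs.
  - by move=> t /andP[t0 _]; rewrite divr_gt0// !mulr_gt0// ltr0n.
  - by rewrite etaE//; lra.
  - move=> [//|[//|t]] _; rewrite !etaE//= -[t.+2%:R]natr1; lra.
  - move=> t /andP[t0 _]; rewrite mul0r add0r.
    have t0' : (0 : R) < t%:R by rewrite ltr0n.
    have eta0 : 0 <= eta t / 2 by rewrite !divr_ge0// ?mulr_ge0// ltW.
    apply: le_trans (ler_wpM2l eta0 M2le) _; rewrite le_eqVlt; apply/orP; left.
    by apply/eqP; rewrite /eta /Q; field; rewrite !gt_eqF.
rewrite lee_fin.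
apply: le_trans (ler_wpM2l _ logle) _; first by rewrite divr_ge0 ?sqr_ge0.
apply: le_trans (ler_wpM2r (rhs2 Delta Delta0) c2).
have -> : 8 * K1 * K2 * (L ^+ 2 * lam ^+ 2 * p%:R * lam1 / (n%:R * Delta * eps ^+ 2)) =
    8 * (n%:R ^+ 2 * L ^+ 2 * (p%:R * (lam * lam1) / eps ^+ 2) * K1) /
    (Delta * n%:R) / n%:R ^+ 2 * (K2 * lam).
  by field; rewrite !gt_eqF.
apply: ler_wpM2r; first by rewrite mulr_ge0 ?(ltW K20) ?(ltW lam0).
apply: ler_wpM2r; first by rewrite invr_ge0 sqr_ge0.
apply: ler_wpM2r; first by rewrite invr_ge0 mulr_ge0// ltW.
by rewrite ler_wpM2l.
Qed.
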